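(* Let $X$ be a real Banach space and let $f:[a,b]\to X$. Then the following are equivalent. (i) There exists a homeomorphism $h$ of $[a,b]$ onto itself such that $f\circ h$ is metrically differentiable at every point of $[a,b]$, and $md(f\circ h,\cdot)$ is continuous on $[a,b]$. (ii) $f$ is continuous, has finite variation on $[a,b]$, and $\mathcal{H}^1(f(M^{\mathrm{b}}_f))=0$.
   Context: For $g:[a,b]\to X$, the unilateral metric derivatives are $md_{\pm}(g,x)=\lim_{t\to0+}\frac{\|g(x\pm t)-g(x)\|}{t}$. If both exist and are equal (and finite), their common value is the metric derivative $md(g,x)$; at an endpoint of $[a,b]$ only the one-sided limit taken inside $[a,b]$ is used. The mapping $g$ is metrically differentiable at $x$ if $md(g,x)$ exists and $\|g(y)-g(z)\|-md(g,x)|y-z|=o(|y-x|+|z-x|)$ as $(y,z)\to(x,x)$ with $y,z\in[a,b]$. $\bigvee_u^v f$ denotes the total variation of $f$ on $[u,v]$; $f$ has finite variation (is BV) if $\bigvee_a^b f<\infty$. $\mathcal{H}^1$ is the $1$-dimensional Hausdorff measure. A point $x\in[a,b]$ is a bilaterally metrically regular point of $f$ if $\frac{\|f(y)-f(z)\|}{\bigvee_y^z f}\to1$ as $(y,z)\to(x,x)$ with $a\le y\le x\le z\le b$, $(y,z)\ne(x,x)$ (in particular the denominator is nonzero for all such $(y,z)$ close to $(x,x)$). $M^{\mathrm{b}}_f$ is the set of all points $x\in[a,b]$ for which there is no $\delta>0$ such that $U=(x-\delta,x+\delta)\subset[a,b]$ and either $f|_U$ is constant or all points of $U$ are bilaterally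 metrically regular points of $f$. In particular $a,b\in M^{\mathrm{b}}_f$. *)

(* Defs.v *)
From HB Require Import structures.
From mathcomp Require Export all_boot all_order all_algebra.
From mathcomp Require Export all_classical all_reals all_analysis.

Set Implicit Arguments.
Unset Strict Implicit.
Unset Printing Implicit Defensive.

Import Order.TTheory GRing.Theory Num.Theory.
Import numFieldNormedType.Exports.

Local Open Scope classical_set_scope.
Local Open Scope ring_scope.

(* A map [a, b] -> X is represented by a total function R -> X; every notion
   below depends only on its values on [a, b]. *)

Section MetricDerivative.
Context {R : realType} {X : normedModType R}.
Implicit Types (a b x m : R) (g : R -> X).

Definition md_right_is g x m : Prop :=
  `|g (x + t) - g x| / t @[t --> 0^'+] --> m.

Definition md_left_is g x m : Prop :=
  `|g (x - t) - g x| / t @[t --> 0^'+] --> m.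

(* The guards drop, at an endpoint, the one-sided limit taken outside [a, b]. *)
Definition md_is a b g x m : Prop :=
  (x < b -> md_right_is g x m) /\ (a < x -> md_left_is g x m).

(* Junk value 0 when the metric derivative does not exist. *)
Definition md a b g x : R := xget 0 [set m | md_is a b g x m].

Definition metrically_differentiable a b g x : Prop :=
  (exists m, md_is a b g x m) /\
  let F := within (`[a, b] `*` `[a, b]) (nbhs (x, x)) in
  (fun p : R * R => `|g p.1 - g p.2| - md a b g x * `|p.1 - p.2|) =o_F
  (fun p : R * R => `|p.1 - x| + `|p.2 - x|).

End MetricDerivative.

Section TotalVariation.
Context {R : realType} {X : normedModType R}.
Implicit Types (u v : R) (f : R -> X).

(* The library's [variation] and [total_variation] are restricted to
   real-valued functions. *)
Definition norm_variation u v f (s : seq R) : R :=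
  let F := f \o nth v (u :: s) in
  \sum_(0 <= n < size s) `|F n.+1 - F n|.

Definition norm_total_variation u v f : \bar R :=
  ereal_sup [set (norm_variation u v f s)%:E | s in itv_partition u v].

End TotalVariation.

Section HausdorffMeasure.
Context {R : realType} {X : normedModType R}.
Implicit Types (A E : set X).
Local Open Scope ereal_scope.

(* The supremum includes 0, so that the empty set has diameter 0. *)
Definition diam E : \bar R :=
  ereal_sup (0 |` [set `|p.1 - p.2|%:E | p in E `*` E]).

Definition hausdorff1_pre (delta : R) A : \bar R :=
  ereal_inf [set \sum_(0 <= i <oo) diam (F i) | F in
    [set F : (set X)^nat |
      A `<=` \bigcup_i F i /\ forall i, diam (F i) <= delta%:E]].

Definition hausdorff1 A : \bar R :=
  ereal_sup [set hausdorff1_pre delta A | delta in [set d : R | (0 < d)%R]].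

End HausdorffMeasure.

Section MetricRegularity.
Context {R : realType} {X : normedModType R}.
Implicit Types (a b x : R) (f : R -> X).

(* Since [fine +oo = 0] and [r / 0 = 0], the quotient is 0 when the variation
   is zero or infinite; convergence to 1 therefore forces the variation to be
   positive and finite for all admissible (y, z) close to (x, x). *)
Definition bilaterally_metrically_regular a b f x : Prop :=
  `|f p.1 - f p.2| / fine (norm_total_variation p.1 p.2 f)
    @[p --> within [set p : R * R |
                     [/\ a <= p.1, p.1 <= x, x <= p.2, p.2 <= b
                       & p <> (x, x)]]
                   (nbhs (x, x))] --> (1 : R).

Definition Mb a b f : set R :=
  [set x | x \in `[a, b] /\
    ~ exists delta : R,
        [/\ 0 < delta,
            `]x - delta, x + delta[ `<=` `[a, b] &
            (exists c : X, forall y : R, y \in `]x - delta, x + delta[ -> f y = c)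
            \/ (forall y : R, y \in `]x - delta, x + delta[ ->
                  bilaterally_metrically_regular a b f y)]].

End MetricRegularity.

Definition homeomorphism_of {T : topologicalType} (A : set T) (h : T -> T) :
    Prop :=
  set_bij A A h /\
  exists k : T -> T,
    [/\ {in A, cancel h k}, {within A, continuous h}
      & {within A, continuous k}].

(* Main.v *)
Require Import Defs.
From HB Require Import structures.
From mathcomp Require Import measurable_realfun ring lra.
Import Order.TTheory GRing.Theory Num.Theory.
Import numFieldNormedType.Exports.
Set Implicit Arguments.
Unset Strict Implicit.
Unset Printing Implicit Defensive.
Local Open Scope classical_set_scope.
Local Open Scope ring_scope.

(** Necessity. Put g = f \o h. A bound K for the metric derivative on an interval
    makes g K-Lipschitz there, so f is continuous and of bounded variation, and
    around a point where md(g) > 0 both the chord and the variation are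
    asymptotic to md(g) times the parameter increment. Hence the points of
    Mb a b f, up to the two endpoints, come from zeros of md(g), whose image is
    null because g is e-Lipschitz on short intervals around each zero.

    Sufficiency. Let v be the variation function of f, mu its Lebesgue-Stieltjes
    measure and C the set of points without a neighbourhood of regular points;
    f(C) = f(Mb a b f). Comparing a chord |f y - f x| with the length of the image
    of [x, y] under |f - f x| gives |f y - f x| <= mu (]x, y] \ C), and summing over
    partitions yields mu C = 0. So there is a continuous p vanishing exactly on C
    with 1 / p mu-integrable. The time change
      u x = \int_(]a, x]) 1 / p dmu + lebesgue_measure (]a, x] /\ C)
    is a homeomorphism, and with h its (rescaled) inverse v \o h is C^1 with
    derivative proportional to p \o h; this is the metric derivative of f \o h,
    since it is 0 on C and chord and arc are asymptotic at regular points. *)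

(** * Epsilon-delta forms of continuity, metric differentiability and regularity *)

Section EpsilonDelta.
Context {R : realType}.
Implicit Types (a b x y z d e m : R).

Lemma within_itv_continuousP {V : normedModType R} a b (F : R -> V) :
  {within `[a, b], continuous F} <->
  forall x, x \in `[a, b] -> forall e, 0 < e -> exists2 d, 0 < d &
    forall y, y \in `[a, b] -> `|y - x| < d -> `|F y - F x| < e.
Proof.
rewrite subspace_continuousP; split=> cF x xab.
  move=> e e0; have /cvgrPdist_lt /(_ e e0) := cF x xab.
  rewrite near_withinE near_nbhs => /nbhs_ballP[d /= d0 dF]; exists d => // y yab yx.
  by rewrite distrC; apply: dF => //; rewrite /ball/= distrC.
apply/cvgrPdist_lt => e e0; have [d d0 dF] := cF x xab e e0.
rewrite near_withinE; apply/nbhs_ballP; exists d => // y; rewrite /ball/= => yx yab.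
by rewrite distrC; apply: dF => //; rewrite distrC.
Qed.

(** The candidate value [m] is a parameter here, so that no argument has to handle the choice
    operator inside [md]. *)
Definition md_approx {X : normedModType R} a b (g : R -> X) x m : Prop :=
  forall e, 0 < e -> exists2 d, 0 < d & forall y z,
    y \in `[a, b] -> z \in `[a, b] -> `|y - x| < d -> `|z - x| < d ->
    `| `|g y - g z| - m * `|y - z| | <= e * (`|y - x| + `|z - x|).

Context {X : normedModType R}.
Implicit Types (f g : R -> X).

(** Freezing one of the two points at [x] turns the two-point estimate into an estimate of the
    difference quotient. *)
Lemma md_approx_md_is a b g x m :
  x \in `[a, b] -> md_approx a b g x m -> md_is a b g x m.
Proof.
rewrite in_itv/= => /andP[ax xb] gm.
have key (y s e : R) : 0 < s -> 0 < e -> `|y - x| = s ->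
    `| `|g y - g x| - m * `|y - x| | <= e / 2 * (`|y - x| + `|x - x|) ->
    `|m - `|g y - g x| / s| < e.
  move=> s0 e0 ->; rewrite subrr normr0 addr0 => h.
  have -> : m - `|g y - g x| / s = - ((`|g y - g x| - m * s) / s) by field; rewrite gt_eqF.
  rewrite normrN normrM normfV (gtr0_norm s0) ltr_pdivrMr//.
  by apply: (le_lt_trans h); rewrite ltr_pM2r// ltr_pdivrMr// ltr_pMr//; lra.
split=> [xltb|altx]; apply/cvgrPdist_lt => e e0; have e20 : 0 < e / 2 by lra.
  have [d d0 gd] := gm _ e20.
  near=> t; have t0 : 0 < t by near: t; exact: nbhs_right_gt.
  have td : t < d by near: t; exact: nbhs_right_lt.
  have tb : t < b - x by near: t; apply: nbhs_right_lt; lra.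
  have xtx : x + t - x = t by lra.
  apply: key => //; first by rewrite xtx gtr0_norm.
  by apply: gd; rewrite ?in_itv/= ?subrr ?normr0 ?xtx ?gtr0_norm//; lra.
have [d d0 gd] := gm _ e20.
near=> t; have t0 : 0 < t by near: t; exact: nbhs_right_gt.
have td : t < d by near: t; exact: nbhs_right_lt.
have tb : t < x - a by near: t; apply: nbhs_right_lt; lra.
have xtx : x - t - x = - t by lra.
apply: key => //; first by rewrite xtx normrN gtr0_norm.
by apply: gd; rewrite ?in_itv/= ?subrr ?normr0 ?xtx ?normrN ?gtr0_norm//; lra.
Unshelve. all: by end_near. Qed.

(** Since [a < b], at least one of the two guards of [md_is] is active at [x], and uniqueness of
    that one-sided limit decides. *)
Lemma md_is_md a b g x m : a < b -> x \in `[a, b] ->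
  md_is a b g x m -> md a b g x = m.
Proof.
rewrite in_itv/= => ab /andP[ax xb] [gr gl]; rewrite /md; case: xgetP => [m' -> []|].
  move=> gr' gl'; have [xlb|bx] := ltP x b.
    by apply: (cvg_unique _ (gr' xlb) (gr xlb)).
  have ax' : a < x by lra.
  exact: (cvg_unique _ (gl' ax') (gl ax')).
by move=> /(_ m)[].
Qed.

Lemma metrically_differentiableP a b g x : a < b -> x \in `[a, b] ->
  metrically_differentiable a b g x <-> exists m, md_approx a b g x m.
Proof.
move=> ab xab; split=> [[_ /= /eqoP gx]|[m gm]].
  exists (md a b g x) => e e0; have := gx e e0.
  rewrite near_withinE near_nbhs => /nbhs_ballP[d /= d0 dg]; exists d => // y z yab zab yx zx.
  rewrite -[X in e * X]ger0_norm ?addr_ge0//; apply: (dg (y, z)) => //.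
  by split; rewrite /ball/= distrC.
have gis := md_approx_md_is xab gm.
split; first by exists m.
rewrite /= (md_is_md ab xab gis); apply/eqoP => e e0; have [d d0 dg] := gm e e0.
rewrite near_withinE; apply/nbhs_ballP; exists d => //= -[y z] [/= yx zx] [/= yab zab].
rewrite [X in e * X]ger0_norm ?addr_ge0//; apply: dg => //; rewrite distrC//.
Qed.

Lemma md_approx_mdE a b g x m : a < b -> x \in `[a, b] ->
  md_approx a b g x m -> md a b g x = m.
Proof. by move=> ab xab /(md_approx_md_is xab); exact: md_is_md. Qed.

Lemma metrically_differentiable_md a b g x : a < b -> x \in `[a, b] ->
  metrically_differentiable a b g x -> md_approx a b g x (md a b g x).
Proof.
by move=> ab xab /(metrically_differentiableP g ab xab)[m gm]; rewrite (md_approx_mdE ab xab gm).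
Qed.

(** As [y <= x <= z], excluding the pair [(x, x)] amounts to [y < z]. *)
Lemma bilaterally_metrically_regularP a b f x :
  bilaterally_metrically_regular a b f x <->
  forall e, 0 < e -> exists2 d, 0 < d & forall y z,
    [/\ a <= y, y <= x, x <= z & z <= b] -> y < z -> x - d < y -> z < x + d ->
    `|1 - `|f y - f z| / fine (norm_total_variation y z f)| < e.
Proof.
split=> [/cvgrPdist_lt fx e e0|fx].
  have := fx e e0; rewrite near_withinE near_nbhs => /nbhs_ballP[d /= d0 dg].
  exists d => // y z [ay yx xz zb] yz xdy zxd; apply: (dg (y, z)) => /=.
    by split; rewrite /ball/= ltr_norml; lra.
  by split => // -[yx' zx']; move: yz; rewrite yx' zx' ltxx.
apply/cvgrPdist_lt => e e0; have [d d0 dg] := fx e e0.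
rewrite near_withinE; apply/nbhs_ballP; exists d => //= -[y z] [/= +  +] [/= ay yx xz zb neq].
rewrite /ball/= !ltr_norml => /andP[yd1 yd2] /andP[zd1 zd2].
have yz : y < z.
  rewrite lt_neqAle (le_trans yx xz) andbT; apply/eqP => yz; apply: neq.
  by congr pair; lra.
by rewrite -ltr_norml; apply: dg => //; lra.
Qed.

End EpsilonDelta.

(** * Total variation of maps into a normed space *)

Section NormVariation.
Context {R : realType} {X : normedModType R}.
Implicit Types (a b u v t x y z e : R) (f : R -> X) (s : seq R).
Local Notation TV := norm_total_variation.

Lemma norm_variation_cons u v f t s :
  norm_variation u v f (t :: s) = `|f t - f u| + norm_variation t v f s.
Proof. by rewrite /norm_variation/= big_nat_recl. Qed.

Lemma norm_variation_cat u v t f s s' : itv_partition u t s ->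
  norm_variation u v f (s ++ s') = norm_variation u t f s + norm_variation t v f s'.
Proof.
elim: s u => [|x s ih] u [/= ps ls].
  by move: ls => /eqP ->; rewrite {2}/norm_variation big_nil add0r.
by move: ps => /andP[_ ps]; rewrite !norm_variation_cons ih// addrA.
Qed.

Lemma norm_variation_le u v f (w : R -> R) s :
  (forall y z, u <= y -> y <= z -> z <= v -> `|f z - f y| <= w z - w y) ->
  itv_partition u v s -> norm_variation u v f s <= w v - w u.
Proof.
elim: s u => [|x s ih] u fw uvs.
  by have /itv_partition_nil -> := uvs; rewrite /norm_variation big_nil subrr.
have [/= /andP[ux ps] ls] := uvs.
have xvs : itv_partition x v s by [].
have xv := itv_partition_le xvs.
rewrite norm_variation_cons; have := fw _ _ (lexx u) (ltW ux) xv.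
have := ih x (fun y z xy yz zv => fw y z (le_trans (ltW ux) xy) yz zv) xvs.
lra.
Qed.

(** The sums telescope. Every upper bound on a variation below comes from this lemma with a suitable
    [w]. *)
Lemma norm_total_variation_le u v f (w : R -> R) :
  (forall y z, u <= y -> y <= z -> z <= v -> `|f z - f y| <= w z - w y) ->
  (TV u v f <= (w v - w u)%:E)%E.
Proof.
by move=> fw; apply: ge_ereal_sup => _ [s uvs <-]; rewrite lee_fin; exact: norm_variation_le.
Qed.

Lemma norm_total_variation_ge u v f : u <= v -> (`|f v - f u|%:E <= TV u v f)%E.
Proof.
rewrite le_eqVlt => /predU1P[->|uv]; apply: ereal_sup_ubound.
  by exists [::]; [split => //=|rewrite /norm_variation big_nil subrr normr0].
exists [:: v]; first exact: itv_partition1.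
by rewrite norm_variation_cons /norm_variation big_nil addr0.
Qed.

Lemma norm_total_variation_ge0 u v f : u <= v -> (0 <= TV u v f)%E.
Proof. by move=> /(norm_total_variation_ge f); apply: le_trans; rewrite lee_fin. Qed.

Lemma norm_total_variation_xx x f : TV x x f = 0%E.
Proof.
apply/eqP; rewrite eq_le norm_total_variation_ge0// andbT.
have -> : 0%E = (0 - 0)%:E :> \bar R by rewrite subrr.
apply: (norm_total_variation_le (w := fun=> 0)) => y z xy yz zx.
have -> : y = x by lra.
have -> : z = x by lra.
by rewrite !subrr normr0.
Qed.

(** Partitions of the two pieces concatenate to one of the whole; the two suprema are then taken one
    after the other. *)
Lemma norm_total_variation_superadd u t v f : u <= t -> t <= v ->
  (TV u t f + TV t v f <= TV u v f)%E.
Proof.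
move=> ut tv.
have [h|] := eqVneq (TV u v f) +oo%E; first by rewrite h leey.
rewrite -ltey => uvoo; have uvfin : TV u v f \is a fin_num.
  by rewrite ge0_fin_numE// norm_total_variation_ge0// (le_trans ut).
have step s s' : itv_partition u t s -> itv_partition t v s' ->
    ((norm_variation u t f s)%:E + (norm_variation t v f s')%:E <= TV u v f)%E.
  move=> us ts; apply: ereal_sup_ubound; exists (s ++ s'); first exact: itv_partition_cat us ts.
  by rewrite (norm_variation_cat _ _ _ us).
have tvs s : itv_partition u t s -> ((norm_variation u t f s)%:E + TV t v f <= TV u v f)%E.
  move=> us; rewrite addeC -leeBrDr//; apply: ge_ereal_sup => _ [s' ts <-].
  by rewrite leeBrDr// addeC; exact: step.
(* A single partition of the left piece is enough to bound the variation on the right piece, which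
   may then be subtracted. *)
have tvfin : TV t v f \is a fin_num.
  rewrite ge0_fin_numE ?norm_total_variation_ge0//.
  have [s us] : exists s, itv_partition u t s.
    move: ut; rewrite le_eqVlt => /predU1P[->|ut]; [by exists [::]|exists [:: t]].
    exact: itv_partition1.
  apply: le_lt_trans uvoo; apply: le_trans (tvs _ us).
  by rewrite leeDr// lee_fin /norm_variation sumr_ge0.
rewrite -leeBrDr//; apply: ge_ereal_sup => _ [s us <-].
by rewrite leeBrDr//; exact: tvs.
Qed.

End NormVariation.

(** * The variation function: additivity and continuity *)

Section VariationFunction.
Context {R : realType} {X : normedModType R}.
Local Notation TV := norm_total_variation.
Variables (a b : R) (f : R -> X).
Hypothesis fBV : (TV a b f < +oo)%E.
Implicit Types (x y z e : R).

Definition variation_fun x := fine (TV a x f).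
Local Notation v := variation_fun.

Lemma norm_total_variation_fin x y : a <= x -> x <= y -> y <= b ->
  TV x y f \is a fin_num.
Proof.
move=> ax xy yb; rewrite ge0_fin_numE ?norm_total_variation_ge0//.
apply: le_lt_trans fBV; have ay := le_trans ax xy.
have := norm_total_variation_superadd f ax xy.
have := norm_total_variation_superadd f ay yb.
have := norm_total_variation_ge0 f ax; have := norm_total_variation_ge0 f yb.
move=> h1 h2 h3 h4; apply: le_trans h3; apply: le_trans (leeDl _ h1).
by apply: le_trans h4; exact: leeDr.
Qed.

Lemma variation_fun_start : v a = 0.
Proof. by rewrite /v norm_total_variation_xx. Qed.

(** One inequality is superadditivity. For the other, [w] follows [v] up to [x] and continues with
    the variation counted from [x]; it dominates the increments of [f], so that [v y] is at most
    [v x + TV x y f]. *)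
Lemma norm_total_variationE x y : a <= x -> x <= y -> y <= b ->
  TV x y f = (v y - v x)%:E.
Proof.
move=> ax xy yb; have ay := le_trans ax xy; have xb := le_trans xy yb.
apply/eqP; rewrite eq_le; apply/andP; split.
  have := norm_total_variation_superadd f ax xy.
  rewrite -[TV x y f]fineK ?norm_total_variation_fin//.
  rewrite -[TV a x f]fineK ?norm_total_variation_fin//.
  rewrite -[TV a y f]fineK ?norm_total_variation_fin// -/(v x) -/(v y).
  by rewrite -EFinD !lee_fin; lra.
pose w s := if s <= x then v s else v x + fine (TV x s f).
have xx : fine (TV x x f) = 0 by rewrite norm_total_variation_xx.
have sup u p q : a <= u -> u <= p -> p <= q -> q <= b ->
    `|f q - f p| <= fine (TV u q f) - fine (TV u p f).
  move=> au up pq qb; have ap := le_trans au up.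
  have := norm_total_variation_superadd f up pq.
  have := norm_total_variation_ge f pq.
  have pb := le_trans pq qb; have uq := le_trans up pq.
  rewrite -[TV u q f]fineK ?norm_total_variation_fin//.
  rewrite -[TV u p f]fineK ?norm_total_variation_fin//.
  rewrite -[TV p q f]fineK ?norm_total_variation_fin//.
  by rewrite -EFinD !lee_fin; lra.
have dom : (TV a y f <= (w y - w a)%:E)%E.
  apply: norm_total_variation_le => p q ap pq qy; rewrite /w.
  have qb := le_trans qy yb.
  have [px|xp] := leP p x; have [qx|xq] := leP q x.
  - exact: sup.
  - have -> : f q - f p = (f q - f x) + (f x - f p) by rewrite addrA subrK.
    have := ler_normD (f q - f x) (f x - f p).
    have := sup a p x (lexx _) ap px xb.
    have := sup x x q ax (lexx _) (ltW xq) qb.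
    by rewrite /v xx; lra.
  - by lra.
  - by have := sup x p q ax (ltW xp) pq qb; lra.
move: dom; rewrite /w ax variation_fun_start.
rewrite -[TV a y f]fineK ?norm_total_variation_fin// -/(v y).
have [yx|_] := leP y x; last first.
  rewrite subr0 -[TV x y f]fineK ?norm_total_variation_fin// !lee_fin; lra.
have -> : y = x by lra.
by move=> _; rewrite subrr norm_total_variation_ge0.
Qed.

Lemma variation_fun_dist x y : a <= x -> x <= y -> y <= b ->
  `|f y - f x| <= v y - v x.
Proof.
move=> ax xy yb; rewrite -lee_fin -norm_total_variationE//.
exact: norm_total_variation_ge.
Qed.

Lemma variation_fun_le x y : a <= x -> x <= y -> y <= b -> v x <= v y.
Proof. by move=> ax xy yb; have := variation_fun_dist ax xy yb; have := normr_ge0 (f y - f x); lra. Qed.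

Hypothesis fcont : {within `[a, b], continuous f}.

(* If v jumped by j at x from the left, subtracting j from v on [x, b] would
   still leave a function dominating the increments of f, since these are
   insensitive to the jump; hence the variation of f would be smaller. *)
Lemma variation_fun_left x e : a < x -> x <= b -> 0 < e ->
  exists y, [/\ a <= y, y < x & v x - e < v y].
Proof.
move=> ax xb e0; apply: contrapT => nh.
have vle y : a <= y -> y < x -> v y <= v x - e.
  by move=> ay yx; rewrite leNgt; apply/negP => h; apply: nh; exists y.
pose w s := if s < x then v s else v s - e.
have : (TV a b f <= (w b - w a)%:E)%E.
  apply: norm_total_variation_le => p q ap pq qb; rewrite /w.
  have [qx|xq] := ltP q x; have [px|xp] := ltP p x.
  - exact: variation_fun_dist.
  - by lra.
  - have fqx := variation_fun_dist (ltW ax) xq qb.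
    (* The chord is split at some [z < x] near [x]: the piece from [z] to [x] is small by continuity
       of [f], and [v z] does not yet contain the jump [e]. *)
    have fxp : `|f x - f p| <= v x - v p - e.
      apply/ler_addgt0Pr => d d0.
      have xab : x \in `[a, b] by rewrite in_itv/= (ltW ax).
      have [r r0 fr] := (within_itv_continuousP a b f).1 fcont x xab d d0.
      pose z := Num.max p (x - r / 2).
      have pz : p <= z by rewrite /z le_max lexx.
      have rz : x - r / 2 <= z by rewrite /z le_max lexx orbT.
      have zx : z < x by rewrite /z gt_max; apply/andP; split => //; lra.
      have : `|f z - f x| < d by apply: fr; rewrite ?in_itv/= ?ltr_norml; lra.
      rewrite distrC => h.
      have zb : z <= b by lra.
      have := variation_fun_dist ap pz zb; have := vle z (le_trans ap pz) zx.
      have := ler_normD (f x - f z) (f z - f p); rewrite addrA subrK; lra.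
    have := ler_normD (f q - f x) (f x - f p); rewrite addrA subrK; lra.
  - by have := variation_fun_dist ap pq qb; lra.
have ab : a <= b by lra.
rewrite norm_total_variationE// lee_fin /w ax ltNge xb/=; lra.
Qed.

(** Mirror image of [variation_fun_left]: a jump on the right of [x] is subtracted from [v] strictly
    after [x]. *)
Lemma variation_fun_right x e : a <= x -> x < b -> 0 < e ->
  exists y, [/\ x < y, y <= b & v y < v x + e].
Proof.
move=> ax xb e0; apply: contrapT => nh.
have vle y : x < y -> y <= b -> v x + e <= v y.
  by move=> ay yx; rewrite leNgt; apply/negP => h; apply: nh; exists y.
pose w s := if s <= x then v s else v s - e.
have : (TV a b f <= (w b - w a)%:E)%E.
  apply: norm_total_variation_le => p q ap pq qb; rewrite /w.
  have [qx|xq] := leP q x; have [px|xp] := leP p x.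
  - exact: variation_fun_dist.
  - by lra.
  - have fqx := variation_fun_dist ap px (ltW xb).
    have fxp : `|f q - f x| <= v q - v x - e.
      apply/ler_addgt0Pr => d d0.
      have xab : x \in `[a, b] by rewrite in_itv/= ax ltW.
      have [r r0 fr] := (within_itv_continuousP a b f).1 fcont x xab d d0.
      pose z := Num.min q (x + r / 2).
      have pz : z <= q by rewrite /z ge_min lexx.
      have rz : z <= x + r / 2 by rewrite /z ge_min lexx orbT.
      have zx : x < z by rewrite /z lt_min; apply/andP; split => //; lra.
      have : `|f z - f x| < d by apply: fr; rewrite ?in_itv/= ?ltr_norml; lra.
      move=> h.
      have az : a <= z by lra.
      have := variation_fun_dist az pz qb; have := vle z zx (le_trans pz qb).
      have := ler_normD (f q - f z) (f z - f x); rewrite addrA subrK; lra.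
    have := ler_normD (f q - f x) (f x - f p); rewrite addrA subrK; lra.
  - by have := variation_fun_dist ap pq qb; lra.
have ab : a <= b by lra.
rewrite norm_total_variationE// lee_fin /w ax [b <= x]leNgt xb/=; lra.
Qed.

Lemma variation_fun_cts x e : x \in `[a, b] -> 0 < e -> exists2 d, 0 < d &
  forall y, y \in `[a, b] -> `|y - x| < d -> `|v y - v x| < e.
Proof.
rewrite in_itv/= => /andP[ax xb] e0.
(* At the endpoint [a] only [y = x] qualifies and any [l < x] will do; likewise for [r] at [b]. *)
have [l [lx vl]] : exists l, l < x /\ forall y, a <= y -> l < y -> y <= x -> v x - e < v y.
  have [altx|xa] := ltP a x; last first.
    exists (x - 1); split; first lra.
    by move=> y ay _ yx; have -> : y = x; lra.
  have [l [al lx vl]] := variation_fun_left altx xb e0; exists l; split => // y ay ly yx.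
  by apply: (lt_le_trans vl); apply: variation_fun_le => //; lra.
have [r [rx vr]] : exists r, x < r /\ forall y, y <= b -> y < r -> x <= y -> v y < v x + e.
  have [xltb|bx] := ltP x b; last first.
    exists (x + 1); split; first lra.
    by move=> y yb _ xy; have -> : y = x; lra.
  have [r [xr rb vr]] := variation_fun_right ax xltb e0; exists r; split => // y yb yr xy.
  by apply: le_lt_trans vr; apply: variation_fun_le => //; lra.
exists (Num.min (x - l) (r - x)); first by rewrite lt_min; apply/andP; split; lra.
move=> y; rewrite in_itv/= lt_min !ltr_norml => /andP[ay yb] /andP[/andP[h1 h2] /andP[h3 h4]].
apply/andP; have [xy|yx] := leP x y.
  by have := variation_fun_le ax xy yb; have := vr y yb; split; lra.
by have := variation_fun_le ay (ltW yx) xb; have := vl y ay; split; lra.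
Qed.

End VariationFunction.

(** A form of compactness of [[a, b]]. The local hypothesis at the supremum of all [s] with [P a s]
    joins some good [s] just before it to a point beyond it, unless [b] is reached. Only intervals
    containing the centre [x] are asked for. *)
Lemma interval_induction {R : realType} (P : R -> R -> Prop) (a b : R) : a <= b ->
  (forall x y z, a <= x -> x <= y -> y <= z -> z <= b -> P x y -> P y z -> P x z) ->
  (forall x, a <= x -> x <= b -> exists2 d, 0 < d & forall p q,
    a <= p -> p <= x -> x <= q -> q <= b -> x - d < p -> q < x + d -> P p q) ->
  P a b.
Proof.
move=> ab Padd Ploc.
pose S := [set s | a <= s <= b /\ P a s].
have Sa : S a.
  have [d d0 Pd] := Ploc a (lexx a) ab.
  by split; [rewrite lexx|apply: Pd => //; lra].
have Sb : has_ubound S by exists b => s [/andP[]].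
have supS : has_sup S by split => //; exists a.
have asup : a <= sup S := ub_le_sup Sb Sa.
have supb : sup S <= b by apply: ge_sup; [exists a|move=> s [/andP[]]].
have [d d0 Pd] := Ploc _ asup supb.
have [s [/andP[as_ sb] Ps] ds] := sup_adherent d0 supS.
have ssup : s <= sup S by apply: (ub_le_sup Sb); split => //; rewrite as_.
pose q := Num.min b (sup S + d / 2).
have qb : q <= b by rewrite /q ge_min lexx.
have qd : q <= sup S + d / 2 by rewrite /q ge_min lexx orbT.
have supq : sup S <= q by rewrite /q le_min supb/=; lra.
have Pq : P a q by apply: (Padd a s q) => //; [lra|apply: Pd => //; lra].
have qsup : q <= sup S by apply: (ub_le_sup Sb); split => //; rewrite qb andbT; lra.
by move: qsup Pq; rewrite /q minEle; case: ifP => // _; lra.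
Qed.

(** * Mean value inequality for the metric derivative *)

Section MetricDerivativeBound.
Context {R : realType} {X : normedModType R}.
Variables (a b : R) (g : R -> X) (m : R -> R).
Hypothesis gm : forall x, x \in `[a, b] -> md_approx a b g x (m x).
Implicit Types (x y z e K : R).

(** Near each point the chords straddling it have slope at most [K + c]; interval induction adds
    them up, and [c] is arbitrarily small. *)
Lemma md_approx_lipschitz y z K : a <= y -> y <= z -> z <= b ->
  (forall x, y <= x -> x <= z -> m x <= K) -> `|g z - g y| <= K * (z - y).
Proof.
move=> ay yz zb mK; apply/ler_addgt0Pr => e e0.
(* The summand 1 keeps the denominator positive when [y = z], and [c * (z - y) <= e]. *)
pose c := e / (z - y + 1).
have c0 : 0 < c by rewrite divr_gt0//; lra.
suff h : `|g z - g y| <= (K + c) * (z - y).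
  apply: (le_trans h); rewrite mulrDl lerD2l /c mulrAC ler_pdivrMr; last lra.
  by rewrite ler_pM2l//; lra.
apply: (interval_induction (P := fun y z => `|g z - g y| <= (K + c) * (z - y))) => //.
  move=> p q r _ _ _ _; have := ler_normD (g r - g q) (g q - g p); rewrite addrA subrK.
  have -> : (K + c) * (r - p) = (K + c) * (r - q) + (K + c) * (q - p) by ring.
  lra.
move=> x yx xz; have xab : x \in `[a, b] by rewrite in_itv/=; lra.
have [d d0 gd] := gm xab c0; exists d => // p q yp px xq qz dp qd.
have := gd q p; rewrite !in_itv/= => /(_ _ _ _ _).
have -> : `|q - x| = q - x by rewrite ger0_norm; lra.
have -> : `|p - x| = x - p by rewrite ler0_norm; lra.
have -> : `|q - p| = q - p by rewrite ger0_norm; lra.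
(* Because [x] lies between [p] and [q], the error term is proportional to the length of the
   interval. *)
have -> : q - x + (x - p) = q - p by ring.
have a1 : a <= q <= b by lra.
have a2 : a <= p <= b by lra.
have a3 : q - x < d by lra.
have a4 : x - p < d by lra.
move=> /(_ a1 a2 a3 a4); rewrite ler_norml => /andP[_ h].
have := mK x yx xz => mxK.
have : m x * (q - p) <= K * (q - p) by apply: ler_wpM2r => //; lra.
rewrite mulrDl; lra.
Qed.

(** With [z = x] and error factor 1, the chord from [x] to [y] is at most [|m x| + 1] times
    [|y - x|]. *)
Lemma md_approx_cts x e : x \in `[a, b] -> 0 < e -> exists2 d, 0 < d &
  forall y, y \in `[a, b] -> `|y - x| < d -> `|g y - g x| < e.
Proof.
move=> xab e0; have [d d0 gd] := gm xab ltr01.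
have M0 : 0 < `|m x| + 1 by have := normr_ge0 (m x); lra.
exists (Num.min d (e / (`|m x| + 1))); first by rewrite lt_min d0 divr_gt0.
move=> y yab; rewrite lt_min ltr_pdivlMr// => /andP[yd ye].
have := gd y x yab xab yd; rewrite subrr normr0 addr0 => /(_ d0).
rewrite ler_norml => /andP[_ h]; apply: le_lt_trans ye.
have := ler_norm (m x) => h2.
have : m x * `|y - x| <= `|m x| * `|y - x| by apply: ler_wpM2r.
by rewrite mulrDr mulr1 (mulrC `|y - x|); lra.
Qed.

End MetricDerivativeBound.

(** * Null sets of the one-dimensional Hausdorff measure *)

Section Hausdorff.
Context {R : realType} {X : normedModType R}.
Implicit Types (A E : set X) (F : seq (set X)).
Local Open Scope ereal_scope.

Lemma diam_ge0 E : 0 <= diam E.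
Proof. by apply: ereal_sup_ubound; left. Qed.

Lemma diam_le E (r : R) : (0 <= r)%R ->
  (forall p q, E p -> E q -> (`|p - q| <= r)%R) -> diam E <= r%:E.
Proof.
move=> r0 Er; apply: ge_ereal_sup => _ [->|[[p q] [/= Ep Eq] <-]].
  by rewrite lee_fin.
by rewrite lee_fin; exact: Er.
Qed.

Lemma diam_ge E p q : E p -> E q -> `|p - q|%:E <= diam E.
Proof. by move=> Ep Eq; apply: ereal_sup_ubound; right; exists (p, q). Qed.

Lemma diam0 : diam (set0 : set X) = 0.
Proof. by apply/eqP; rewrite eq_le diam_ge0 andbT; apply: diam_le. Qed.

Lemma hausdorff1_ge0 A : 0 <= hausdorff1 A.
Proof.
apply: (@le_trans _ _ (hausdorff1_pre 1 A)).
  by apply: le_ereal_inf_tmp => _ [F _ <-]; apply: nneseries_ge0 => n _ _; exact: diam_ge0.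
by apply: ereal_sup_ubound; exists 1%R => /=.
Qed.

(** Finite covers suffice: a list padded with [set0], of diameter 0, is a countable cover with the
    same sum. *)
Lemma hausdorff1_eq0 A :
  (forall d e : R, (0 < d)%R -> (0 < e)%R -> exists F,
    [/\ A `<=` \bigcup_i nth set0 F i, forall i, diam (nth set0 F i) <= d%:E
      & \sum_(E <- F) diam E <= e%:E]) ->
  hausdorff1 A = 0.
Proof.
move=> AF; apply/eqP; rewrite eq_le hausdorff1_ge0 andbT.
apply: ge_ereal_sup => _ [d /= d0 <-]; apply/lee_addgt0Pr => e e0; rewrite add0e.
have [F [AF' Fd Fe]] := AF d e d0 e0; apply: le_trans Fe.
apply: (@le_trans _ _ (\sum_(0 <= i <oo) diam (nth set0 F i))).
  by apply: ereal_inf_lbound; exists (fun i => nth set0 F i).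
apply: lime_le; first by apply: is_cvg_nneseries => n _ _; exact: diam_ge0.
apply: nearW => n; elim: F n {AF' Fd} => [|E F ih] n.
  by rewrite big_nil big1// => i _; rewrite nth_nil diam0.
case: n => [|n].
  by rewrite big_geq// sume_ge0// => i _; exact: diam_ge0.
by rewrite big_nat_recl//= big_cons; apply: leeD.
Qed.

(** The scale 1 is arbitrary; the bound on the diameters later serves to make them finite. *)
Lemma hausdorff1_eq0_cover A (e : R) : hausdorff1 A = 0 -> (0 < e)%R ->
  exists F : (set X)^nat, [/\ A `<=` \bigcup_i F i, forall i, diam (F i) <= 1%:E
    & \sum_(0 <= i <oo) diam (F i) < e%:E].
Proof.
move=> A0 e0; have : hausdorff1_pre 1 A < e%:E.
  rewrite (le_lt_trans _ (_ : 0 < e%:E)) ?lte_fin// -A0.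
  by apply: ereal_sup_ubound; exists 1%R => /=.
by move=> /ereal_inf_lt[_ [F [AF Fd] <-] Fe]; exists F.
Qed.

Lemma hausdorff1_le0 A E : A `<=` E -> hausdorff1 E = 0 -> hausdorff1 A = 0.
Proof.
move=> AE E0; apply/eqP; rewrite eq_le hausdorff1_ge0 andbT -E0.
apply: ge_ereal_sup => _ [d /= d0 <-].
apply: (@le_trans _ _ (hausdorff1_pre d E)); last first.
  by apply: ereal_sup_ubound; exists d.
apply: ereal_inf_le_tmp => _ [F [EF Fd] <-]; exists F => //; split => //.
exact: subset_trans EF.
Qed.

End Hausdorff.

(** * Necessity: [m] is the metric derivative of [g], [k] the inverse homeomorphism, [sg] the
    orientation of [k] *)

Section Necessity.
Context {R : realType} {X : normedModType R}.
Variables (a b : R) (f g : R -> X) (m k : R -> R) (sg : R).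
Hypothesis ab : a < b.
Hypothesis gm : forall x, x \in `[a, b] -> md_approx a b g x (m x).
Hypothesis mcont : {within `[a, b], continuous m}.
Hypothesis kcont : {within `[a, b], continuous k}.
Hypothesis kab : forall y, y \in `[a, b] -> k y \in `[a, b].
Hypothesis kinj : {in `[a, b] &, injective k}.
Hypothesis kmono : forall y z, a <= y -> y <= z -> z <= b ->
  `|k z - k y| = sg * (k z - k y).
Hypothesis fgk : forall y, y \in `[a, b] -> f y = g (k y).
Implicit Types (x y z c r e M : R).
Local Notation TV := norm_total_variation.

(** The increments of [f] are dominated by those of [M * sg * k]. The bound on [m] is asked for only
    near [c], so that the lemma gives both finiteness of the variation and its local asymptotics. *)
Lemma reparam_variation_le y z c r M : a <= y -> y <= z -> z <= b ->
  (forall s, y <= s -> s <= z -> `|k s - c| < r) ->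
  (forall x, x \in `[a, b] -> `|x - c| < r -> m x <= M) ->
  (TV y z f <= (M * `|k z - k y|)%:E)%E.
Proof.
move=> ay yz zb kr mM.
rewrite kmono// mulrA mulrBr.
apply: (norm_total_variation_le (w := fun s => M * sg * k s)) => p q yp pq qz.
have pab : p \in `[a, b] by rewrite in_itv/=; lra.
have qab : q \in `[a, b] by rewrite in_itv/=; lra.
rewrite -mulrBr -mulrA -kmono; try lra.
rewrite !fgk//.
have := kr p yp (le_trans pq qz); have := kr q (le_trans yp pq) qz; rewrite !ltr_norml.
move=> /andP[q1 q2] /andP[p1 p2].
have := kab pab; have := kab qab; rewrite !in_itv/= => /andP[q3 q4] /andP[p3 p4].
have [kpq|/ltW kqp] := leP (k p) (k q).
  rewrite [X in M * X]ger0_norm; last lra.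
  apply: (md_approx_lipschitz gm) => // x px xq; apply: mM; rewrite ?in_itv/= ?ltr_norml; lra.
rewrite distrC [X in M * X]ler0_norm ?opprB; last lra.
apply: (md_approx_lipschitz gm) => // x px xq; apply: mM; rewrite ?in_itv/= ?ltr_norml; lra.
Qed.

Lemma reparam_continuous : {within `[a, b], continuous f}.
Proof.
apply/within_itv_continuousP => x xab e e0.
have [d d0 gd] := md_approx_cts gm (kab xab) e0.
have [r r0 kr] := (within_itv_continuousP a b k).1 kcont x xab d d0.
by exists r => // y yab yx; rewrite !fgk//; apply: gd; [exact: kab|exact: kr].
Qed.

Lemma reparam_bounded_variation : (TV a b f < +oo)%E.
Proof.
have [c cab mc] := EVT_max (ltW ab) mcont.
apply: le_lt_trans (ltry (m c * `|k b - k a|)).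
(* With this radius every point of [[a, b]] counts as near [a]. *)
apply: (reparam_variation_le (c := a) (r := b - a + 1)) => //; first exact: ltW.
  move=> s sa sb; have := kab (_ : s \in `[a, b]); rewrite !in_itv/= sa sb => /(_ isT).
  by rewrite ltr_norml; lra.
by move=> x xab _; exact: mc.
Qed.

(** Chord and variation both lie between [m0' - eta] and [m0' + eta] times [|k q - k p|], so their
    quotient is close to 1. *)
Lemma reparam_regular y : y \in `[a, b] -> 0 < m (k y) ->
  bilaterally_metrically_regular a b f y.
Proof.
move=> yab m0; apply/bilaterally_metrically_regularP => e e0.
set m0' := m (k y) in m0.
(* The final estimate needs [2 * eta < e * (m0' - eta)]; taking 3 for 2 in the denominator makes it
   strict. *)
pose eta := e * m0' / (3 + e).
have eta0 : 0 < eta by rewrite divr_gt0 ?mulr_gt0//; lra.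
have etaE : eta * (3 + e) = e * m0' by rewrite /eta divfK// gt_eqF//; lra.
have [d1 d10 md1] := (within_itv_continuousP a b (m : R -> R^o)).1 mcont (k y) (kab yab) eta eta0.
have [d2 d20 gd2] := gm (kab yab) eta0.
have d0 : 0 < Num.min d1 d2 by rewrite lt_min d10.
have [r r0 kr] := (within_itv_continuousP a b (k : R -> R^o)).1 kcont y yab _ d0.
exists r => // p q [ap py yq qb] pq rp qr.
have pab : p \in `[a, b] by rewrite in_itv/=; lra.
have qab : q \in `[a, b] by rewrite in_itv/=; lra.
have kpq : 0 < `|k q - k p|.
  rewrite normr_gt0 subr_eq0; apply/eqP => /(kinj qab pab) h; lra.
have ksr s : p <= s -> s <= q -> `|k s - k y| < Num.min d1 d2.
  by move=> ps sq; apply: kr; rewrite ?in_itv/= ?ltr_norml; lra.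
have up : (TV p q f <= ((m0' + eta) * `|k q - k p|)%:E)%E.
  apply: (reparam_variation_le (c := k y) (r := Num.min d1 d2)) => //; first exact: ltW.
  move=> x xab; rewrite lt_min => /andP[xd1 _].
  by have := md1 x xab xd1; rewrite ltr_norml => /andP[_]; rewrite /m0'; lra.
have lo : (`|f p - f q|%:E <= TV p q f)%E.
  by rewrite distrC; apply: norm_total_variation_ge; exact: ltW.
have lo2 : (m0' - eta) * `|k q - k p| <= `|f p - f q|.
  have := gd2 (k p) (k q) (kab pab) (kab qab).
  have := ksr p (lexx p) (ltW pq); have := ksr q (ltW pq) (lexx q).
  rewrite !lt_min => /andP[_ h1] /andP[_ h2] /(_ h2 h1).
  (* By monotonicity [k y] lies between [k p] and [k q], so the two distances in the error term add
     up to [|k q - k p|]. *)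
  rewrite [`|k p - k y|]distrC (kmono ap py) ?(kmono _ yq qb); try lra.
  rewrite -mulrDr addrA.
  have -> : k y - k p + k q - k y = k q - k p by ring.
  rewrite -(kmono ap (ltW pq) qb) -!fgk// [`|k p - k q|]distrC ler_norml.
  by rewrite mulrBl => /andP[+ _]; rewrite /m0'; lra.
have fin : TV p q f \is a fin_num.
  rewrite ge0_fin_numE; last by apply: norm_total_variation_ge0; exact: ltW.
  by apply: (le_lt_trans up); rewrite ltry.
move: up lo; rewrite -[TV p q f]fineK// !lee_fin /=.
set V := fine (TV p q f); set D := `|k q - k p| in kpq lo2 *; set N := `|f p - f q| in lo2 * => up lo.
have meta : eta < m0' by nra.
have V0 : 0 < V by apply: (lt_le_trans _ lo); apply: (lt_le_trans _ lo2); rewrite mulr_gt0//; lra.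
have -> : 1 - N / V = (V - N) / V by rewrite mulrBl divff// gt_eqF.
rewrite ger0_norm; last by rewrite divr_ge0//; lra.
rewrite ltr_pdivrMr//.
have h1 : V - N <= 2 * eta * D by nra.
have h2 : (m0' - eta) * D <= V by lra.
have h3 : 2 * eta * D < e * ((m0' - eta) * D).
  rewrite mulrA ltr_pM2r//; nra.
apply: (le_lt_trans h1); apply: (lt_le_trans h3); rewrite ler_pM2l//.
Qed.

(** At an interior point with [m (k x) > 0], continuity keeps [m \o k] positive nearby, and all
    nearby points are regular. *)
Lemma Mb_reparam x : Mb a b f x -> [\/ x = a, x = b | m (k x) <= 0].
Proof.
move=> [xab nx]; have [->|/eqP xa] := eqVneq x a; first by constructor 1.
have [->|/eqP xb] := eqVneq x b; first by constructor 2.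
constructor 3; rewrite leNgt; apply/negP => m0; apply: nx.
have [d1 d10 md1] := (within_itv_continuousP a b (m : R -> R^o)).1 mcont (k x) (kab xab) _ m0.
have [r r0 kr] := (within_itv_continuousP a b (k : R -> R^o)).1 kcont x xab _ d10.
move: (xab); rewrite in_itv/= => /andP[ax xlb].
have {xa}ax : a < x by rewrite lt_neqAle ax andbT; apply/eqP => /esym.
have {xb}xlb : x < b by rewrite lt_neqAle xlb andbT; apply/eqP.
pose d := Num.min r (Num.min (x - a) (b - x)).
have dr : d <= r by rewrite /d ge_min lexx.
have da : d <= x - a by rewrite /d !ge_min lexx orbT.
have db : d <= b - x by rewrite /d !ge_min lexx !orbT.
exists d; split; first by rewrite /d !lt_min r0/=; lra.
  by move=> y /=; rewrite !in_itv/= => /andP[h1 h2]; lra.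
right=> y; rewrite in_itv/= => /andP[h1 h2].
have yab : y \in `[a, b] by rewrite in_itv/=; lra.
apply: reparam_regular => //.
have /md1 : k y \in `[a, b] by exact: kab.
have -> : `|k y - k x| < d1 by apply: kr => //; rewrite ltr_norml; lra.
by move=> /(_ isT); rewrite ltr_norml => /andP[]; lra.
Qed.

(** A Sard-type argument by interval induction: covers of adjacent intervals concatenate, and their
    total diameter is at most [e] times the length. *)
Lemma critical_cover (d e : R) : 0 < d -> 0 < e -> exists F : seq (set X),
  [/\ g @` [set x | x \in `[a, b] /\ m x <= 0] `<=` \bigcup_i nth set0 F i,
      forall i, (diam (nth set0 F i) <= d%:E)%E
    & (\sum_(E <- F) diam E <= (e * (b - a))%:E)%E].
Proof.
move=> d0 e0.
pose P p q := exists F : seq (set X),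
  [/\ g @` [set x | x \in `[p, q] /\ m x <= 0] `<=` \bigcup_i nth set0 F i,
      forall i, (diam (nth set0 F i) <= d%:E)%E
    & (\sum_(E <- F) diam E <= (e * (q - p))%:E)%E].
apply: (@interval_induction _ P a b (ltW ab)).
  move=> x y z ax xy yz zb [F [cF dF sF]] [G [cG dG sG]]; exists (F ++ G); split.
  - move=> _ [t [txz mt] <-]; move: txz; rewrite in_itv/= => /andP[xt tz].
    have [ty|/ltW yt] := leP t y.
      have /cF[i _ it] : [set g x0 | x0 in [set x0 | x0 \in `[x, y] /\ m x0 <= 0]] (g t).
        by exists t => //; split => //; rewrite in_itv/= xt.
      exists i => //; rewrite nth_cat; case: ltnP => // si.
      by move: it; rewrite nth_default.
    have /cG[i _ it] : [set g x0 | x0 in [set x0 | x0 \in `[y, z] /\ m x0 <= 0]] (g t).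
      by exists t => //; split => //; rewrite in_itv/= yt.
    exists (size F + i)%N => //; rewrite nth_cat ltnNge leq_addr/=.
    by rewrite addKn.
  - by move=> i; rewrite nth_cat; case: ifP.
  - rewrite big_cat/=; apply: (le_trans (leeD sF sG)); rewrite -EFinD lee_fin.
    by rewrite -mulrDr; apply: ler_wpM2l; lra.
move=> x ax xb; have xab : x \in `[a, b] by rewrite in_itv/= ax.
have [mx|mx] := leP (m x) 0.
  have [r r0 mr] := (within_itv_continuousP a b (m : R -> R^o)).1 mcont x xab e e0.
  (* An interval within [r'] of [x] is shorter than [2 * r'], and [g] is [e]-Lipschitz on it; its
     image has diameter at most [d]. *)
  pose r' := Num.min r (d / (2 * e)).
  have r'r : r' <= r by rewrite /r' ge_min lexx.
  have r'd : r' * (2 * e) <= d by rewrite -ler_pdivlMr ?mulr_gt0// /r' ge_min lexx orbT.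
  exists r'; first by rewrite lt_min r0 divr_gt0// mulr_gt0.
  move=> p q ap px xq qb rp qr.
  have key s t : p <= s -> s <= t -> t <= q -> `|g t - g s| <= e * (t - s).
    move=> ps st tq; apply: (md_approx_lipschitz gm); try lra.
    move=> y sy yt; have yab : y \in `[a, b] by rewrite in_itv/=; lra.
    have := mr y yab; rewrite !ltr_norml => /(_ _)/andP; case; lra.
  have dg : (diam (g @` `[p, q]) <= (e * (q - p))%:E)%E.
    apply: diam_le; first by rewrite mulr_ge0//; lra.
    move=> _ _ [s /= + <-] [t /= + <-]; rewrite !in_itv/= => /andP[s1 s2] /andP[t1 t2].
    have [st|/ltW ts] := leP s t.
      rewrite distrC; apply: (le_trans (key _ _ s1 st t2)).
      by apply: ler_wpM2l; lra.
    by apply: (le_trans (key _ _ t1 ts s2)); apply: ler_wpM2l; lra.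
  exists [:: g @` `[p, q]]; split.
  - by move=> _ [t [tpq _] <-]; exists 0%N => //=; exists t.
  - move=> [|i] /=; last by rewrite nth_nil diam0 lee_fin ltW.
    by apply: (le_trans dg); rewrite lee_fin; nra.
  - by rewrite big_seq1.
(* Where [m x > 0] there are no critical points nearby, and the empty list is a cover. *)
have [r r0 mr] := (within_itv_continuousP a b (m : R -> R^o)).1 mcont x xab _ mx.
exists r => // p q ap px xq qb rp qr; exists [::]; split.
- move=> _ [t [tpq mt] <-]; move: tpq; rewrite in_itv/= => /andP[t1 t2].
  have tab : t \in `[a, b] by rewrite in_itv/=; lra.
  by have := mr t tab; rewrite !ltr_norml => /(_ _)/andP; case; lra.
- by move=> i; rewrite nth_nil diam0 lee_fin ltW.
- by rewrite big_nil lee_fin mulr_ge0//; lra.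
Qed.

Lemma hausdorff1_Mb_reparam : hausdorff1 (f @` Mb a b f) = 0%E.
Proof.
apply: hausdorff1_eq0 => d e d0 e0.
have ba0 : 0 < b - a by rewrite subr_gt0.
have [F [cF dF sF]] := critical_cover d0 (divr_gt0 e0 ba0).
have diam1 (x : X) : diam [set x] = 0%E.
  apply/eqP; rewrite eq_le diam_ge0 andbT; apply: diam_le => // p q -> ->.
  by rewrite subrr normr0.
exists ([set f a] :: [set f b] :: F); split.
- move=> _ [x Mx <-]; have [xab _] := Mx.
  case: (Mb_reparam Mx) => [->|->|mx]; [by exists 0%N|by exists 1%N|].
  have /cF[i _ it] : [set g x | x in [set x | x \in `[a, b] /\ m x <= 0]] (f x).
    by exists (k x); rewrite ?fgk//; split => //; exact: kab.
  by exists i.+2.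
- by move=> [|[|i]] /=; [rewrite diam1 lee_fin ltW|rewrite diam1 lee_fin ltW|exact: dF].
- by rewrite !big_cons !diam1 !add0e; move: sF; rewrite divfK// gt_eqF.
Qed.

End Necessity.

Lemma md_continuous_necessary (R : realType) (X : normedModType R)
    (a b : R) (f : R -> X) (h : R -> R) : a < b ->
  homeomorphism_of `[a, b] h ->
  (forall x : R, x \in `[a, b] -> metrically_differentiable a b (f \o h) x) ->
  {within `[a, b], continuous (md a b (f \o h))} ->
  [/\ {within `[a, b], continuous f}, (norm_total_variation a b f < +oo)%E
    & hausdorff1 (f @` Mb a b f) = 0%E].
Proof.
move=> ab [[hfun hinj hsurj] [k [hk hcont kcont]]] hmd mdcont.
have kh y : y \in `[a, b] -> k y \in `[a, b] /\ h (k y) = y.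
  by move=> /hsurj[x xab <-]; rewrite hk ?inE.
have kab y : y \in `[a, b] -> k y \in `[a, b] by move=> /kh[].
have kinj : {in `[a, b] &, injective k}.
  by move=> y z /kh[_ hy] /kh[_ hz] kyz; rewrite -hy -hz kyz.
have fgk y : y \in `[a, b] -> f y = (f \o h) (k y) by move=> /kh[_ /= ->].
have gm x : x \in `[a, b] -> md_approx a b (f \o h) x (md a b (f \o h) x).
  by move=> xab; apply: metrically_differentiable_md => //; exact: hmd.
(* A continuous injection of an interval is strictly monotone; the sign covers both orientations at
   once. *)
have [sg kmono] : exists sg, forall y z, a <= y -> y <= z -> z <= b ->
    `|k z - k y| = sg * (k z - k y).
  have [kmono|kmono] := itv_continuous_inj_mono kcont kinj; [exists 1|exists (- 1)];
    move=> y z ay yz zb; (have yab : y \in `[a, b] by rewrite in_itv/=; lra);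
    (have zab : z \in `[a, b] by rewrite in_itv/=; lra);
    (move: yz; rewrite le_eqVlt => /predU1P[->|yz]; first by rewrite subrr normr0 mulr0).
  - by rewrite mul1r gtr0_norm// subr_gt0; exact: kmono.
  - by rewrite mulN1r ltr0_norm// subr_lt0; exact: kmono.
split.
- exact: (reparam_continuous gm kcont kab fgk).
- exact: (reparam_bounded_variation ab gm mdcont kab kmono fgk).
- exact: (hausdorff1_Mb_reparam ab gm mdcont kcont kab kinj kmono fgk).
Qed.

(** * The Lebesgue-Stieltjes measure of a continuous monotone function *)

Section VariationMeasure.
Context {R : realType}.
Variables (a b : R) (v : R -> R).
Hypothesis ab : a < b.
Hypothesis v_nd : forall x y, a <= x -> x <= y -> y <= b -> v x <= v y.
Hypothesis v_cts : forall x e, x \in `[a, b] -> 0 < e -> exists2 d, 0 < d &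
  forall y, y \in `[a, b] -> `|y - x| < d -> `|v y - v x| < e.
Implicit Types (x y e : R).

Definition clamp x := Num.max a (Num.min x b).

Lemma clamp_in x : a <= clamp x /\ clamp x <= b.
Proof.
split; rewrite /clamp; first by rewrite le_max lexx.
by rewrite ge_max (ltW ab) ge_min lexx orbT.
Qed.

Lemma clamp_id x : a <= x -> x <= b -> clamp x = x.
Proof. by move=> ax xb; rewrite /clamp (min_idPl xb) (max_idPr ax). Qed.

Lemma clamp_le x y : x <= y -> clamp x <= clamp y.
Proof.
move=> xy; rewrite /clamp ge_max le_max lexx/= le_max; apply/orP; right.
by rewrite le_min !ge_min xy lexx !orbT.
Qed.

Lemma clamp_dist x y : `|clamp x - clamp y| <= `|x - y|.
Proof.
wlog xy : x y / x <= y.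
  move=> h; have [/h//|/ltW/h] := leP x y.
  by rewrite distrC (distrC y).
rewrite [leRHS]ler0_norm ?ler0_norm ?subr_le0//; last exact: clamp_le.
rewrite !opprB /clamp; have [] := leP x b; have [] := leP y b; move=> *;
by rewrite !maxEle; do ![case: ifPn => ?]; lra.
Qed.

(** Constant extension of [v] outside [[a, b]]: a Stieltjes measure requires a cumulative function
    on the whole line. *)
Definition clamped x := v (clamp x).

Lemma clamped_id x : a <= x -> x <= b -> clamped x = v x.
Proof. by move=> ax xb; rewrite /clamped clamp_id. Qed.

Lemma clamped_nondecreasing : nondecreasing clamped.
Proof.
move=> x y xy; rewrite /clamped; apply: v_nd; [|exact: clamp_le|];
by have [] := clamp_in x; have [] := clamp_in y.
Qed.

Lemma clamped_right_continuous : right_continuous clamped.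
Proof.
apply: right_continuousW => x; apply/cvgrPdist_lt => e e0.
have cab y : clamp y \in `[a, b] by rewrite in_itv/=; apply/andP; exact: clamp_in.
have [d d0 vd] := v_cts (cab x) e0.
apply/nbhs_ballP; exists d => //= y xy; rewrite distrC; apply: vd => //.
by apply: (le_lt_trans (clamp_dist _ _)); rewrite distrC.
Qed.

HB.instance Definition _ := isCumulative.Build R _ R clamped
  clamped_nondecreasing clamped_right_continuous.

Definition variation_measure := lebesgue_stieltjes_measure clamped.
HB.instance Definition _ := Measure.on variation_measure.

Lemma variation_measure_itv x y : a <= x -> x <= y -> y <= b ->
  variation_measure `]x, y] = (v y - v x)%:E.
Proof.
move=> ax xy yb; rewrite /variation_measure/lebesgue_stieltjes_measure/measure_extension.
rewrite measurable_mu_extE/=; last exact: is_ocitv.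
by rewrite wlength_itv_bnd// !clamped_id//; lra.
Qed.

(** The set lies in the segment from [inf S] to [inf S + r]. Lebesgue outer measure is used because
    images of sets need not be measurable. *)
Lemma lebesgue_outer_le (S : set R) (r : R) : 0 <= r ->
  (forall p q, S p -> S q -> `|p - q| <= r) -> ((wlength (@idfun R))^*%mu S <= r%:E)%E.
Proof.
move=> r0 Sr; have [->|/set0P[p0 Sp0]] := eqVneq S set0.
  by rewrite outer_measure0.
have Sl : has_lbound S.
  by exists (p0 - r) => p Sp; have := Sr _ _ Sp0 Sp; rewrite ler_norml => /andP[]; lra.
have : S `<=` `[inf S, inf S + r].
  move=> p Sp /=; rewrite in_itv/=; apply/andP; split; first exact: ge_inf.
  rewrite -lerBlDr; apply: lb_le_inf; first by exists p0.
  by move=> q Sq; have := Sr _ _ Sp Sq; rewrite ler_norml => /andP[]; lra.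
move=> /(le_outer_measure (wlength (@idfun R))^*%mu) /le_trans; apply.
have := lebesgue_measure_itv `[inf S, inf S + r].
rewrite /= lte_fin; case: ifP => _ h; rewrite [leLHS]h; last by rewrite lee_fin.
by rewrite -EFinB lee_fin; lra.
Qed.

(** In any cover of [E] by half-open intervals, the part of [E] in one interval has an image of
    diameter at most the increment of [v] over it. *)
Lemma lebesgue_outer_image (rho : R -> R) (E : set R) :
  (forall x, E x -> x \in `[a, b]) ->
  (forall x y, a <= x -> x <= y -> y <= b -> `|rho y - rho x| <= v y - v x) ->
  ((wlength (@idfun R))^*%mu (rho @` E) <= variation_measure E)%E.
Proof.
move=> Eab rhov.
apply: le_ereal_inf_tmp => _ [A [mA EA] <-].
apply: (@le_trans _ _ ((wlength (@idfun R))^*%mu (\bigcup_k rho @` (E `&` A k)))%E).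
  apply: le_outer_measure => _ [x Ex <-]; have [k _ Akx] := EA x Ex.
  by exists k => //; exists x.
apply: le_trans (outer_measure_sigma_subadditive _ _) _.
apply: lee_nneseries => [k _ _|k _]; first exact: outer_measure_ge0.
have [[x y] _ Akxy] := mA k; rewrite -Akxy /=.
have [xy|yx] := leP x y; last first.
  rewrite (_ : E `&` _ = set0) ?image_set0 ?outer_measure0; last first.
    by rewrite set_itv_ge ?setI0// bnd_simp -leNgt ltW.
  exact: wlength_ge0.
rewrite wlength_itv_bnd//; apply: lebesgue_outer_le.
  by rewrite subr_ge0; exact: clamped_nondecreasing.
have key p q : E p -> E q -> x < p -> q <= y -> p <= q ->
    `|rho q - rho p| <= clamped y - clamped x.
  move=> /Eab + /Eab; rewrite !in_itv/= => /andP[ap pb] /andP[aq qb] xp qy pq.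
  apply: (le_trans (rhov _ _ ap pq qb)).
  rewrite -(clamped_id ap pb) -(clamped_id aq qb).
  by apply: lerB; apply: clamped_nondecreasing => //; exact: ltW.
move=> _ _ [p [Ep pA] <-] [q [Eq qA] <-]; move: pA qA; rewrite /= !in_itv/=.
move=> /andP[xp py] /andP[xq qy].
have [pq|/ltW qp] := leP p q; last exact: key.
by rewrite distrC; exact: key.
Qed.

End VariationMeasure.

(** * A closed set with null image carries no arc length *)

Section CriticalNull.
Context {R : realType} {X : normedModType R}.
Variables (a b : R) (f : R -> X) (C : set R).
Hypothesis ab : a < b.
Hypothesis fcont : {within `[a, b], continuous f}.
Hypothesis fBV : (norm_total_variation a b f < +oo)%E.
Hypothesis Cclosed : closed C.
Hypothesis Cnull : hausdorff1 (f @` C) = 0%E.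
Implicit Types (x y z e : R).
Local Notation v := (variation_fun a f).
Local Notation lam := (wlength (@idfun R))^*%mu.

Definition curve_measure := variation_measure ab
  (variation_fun_le fBV) (variation_fun_cts fBV fcont).
HB.instance Definition _ := Measure.on curve_measure.
Local Notation mu := curve_measure.

Lemma curve_measure_itv x y : a <= x -> x <= y -> y <= b ->
  mu `]x, y] = (v y - v x)%:E.
Proof. exact: variation_measure_itv. Qed.

(** The distance to [c] is 1-Lipschitz, so it maps a cover of [f @] C to a cover with no larger
    diameters. *)
Lemma lebesgue_outer_dist_null (c : X) :
  (lam [set `|f x - c|%R | x in C] <= 0)%E.
Proof.
apply/lee_addgt0Pr => e e0; rewrite add0e.
have [F [CF F1 Fe]] := hausdorff1_eq0_cover Cnull e0.
apply: (le_trans _ (ltW Fe)).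
apply: (@le_trans _ _ (lam (\bigcup_i [set `|y - c| | y in F i]))).
  apply: le_outer_measure => _ [x Cx <-].
  by have [i _ Fi] := CF (f x) (ex_intro2 _ _ x Cx erefl); exists i => //; exists (f x).
apply: le_trans (outer_measure_sigma_subadditive _ _) _.
apply: lee_nneseries => [k _ _|k _]; first exact: outer_measure_ge0.
have dfin : diam (F k) \is a fin_num.
  by rewrite ge0_fin_numE ?diam_ge0// (le_lt_trans (F1 k))// ltry.
rewrite -[leRHS]fineK//; apply: lebesgue_outer_le; first by rewrite fine_ge0// diam_ge0.
move=> _ _ [p Fp <-] [q Fq <-].
apply: (@le_trans _ _ `|p - q|).
  by apply: (le_trans (ler_dist_dist _ _)); rewrite opprB addrA subrK.
by rewrite -lee_fin fineK// diam_ge.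
Qed.

Lemma measurable_C : measurable (C : set (measurableTypeR R)).
Proof. exact: closed_measurable. Qed.

(** By the intermediate value theorem [rho] attains every value up to [|f y - f x|]. Those attained
    on [C] form a null set, and the others have measure at most that of []x, y] \ C]. *)
Lemma dist_le_curve_measure x y : a <= x -> x <= y -> y <= b ->
  (`|f y - f x|%:E <= mu (`]x, y] `\` C))%E.
Proof.
move=> ax xy yb.
pose rho z := `|f z - f x|.
have rhov p q : a <= p -> p <= q -> q <= b -> `|rho q - rho p| <= v q - v p.
  move=> ap pq qb; apply: le_trans (variation_fun_dist fBV ap pq qb).
  by apply: (le_trans (ler_dist_dist _ _)); rewrite opprB addrA subrK.
have rcts : {within `[x, y], continuous rho}.
  apply/(within_itv_continuousP x y (rho : R -> R^o)) => z; rewrite in_itv/= => /andP[xz zy] e e0.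
  have zab : z \in `[a, b] by rewrite in_itv/=; lra.
  have [d d0 fd] := (within_itv_continuousP a b f).1 fcont z zab e e0.
  exists d => // z'; rewrite in_itv/= => /andP[xz' zy'] zd.
  apply: le_lt_trans (fd z' _ zd); last by rewrite in_itv/=; lra.
  by apply: (le_trans (ler_dist_dist _ _)); rewrite opprB addrA subrK.
have rx : rho x = 0 by rewrite /rho subrr normr0.
(* Leaving out the value 0 keeps the preimage different from [x], hence inside []x, y]]. *)
have sub : `]0, rho y] `<=`
    [set `|f z - f x| | z in C] `|` rho @` (`]x, y] `\` C).
  move=> t /=; rewrite in_itv/= => /andP[t0 ty].
  have [|z] := IVT xy rcts (v := t).
    by rewrite rx (min_idPl _) ?(max_idPr _) ?(ltW t0)//; exact: normr_ge0.
  rewrite in_itv/= => /andP[xz zy] zt.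
  have [Cz|nCz] := pselect (C z); first by left; exists z.
  right; exists z => //; split => //=; rewrite in_itv/= zy andbT lt_neqAle xz andbT.
  by apply/eqP => xz'; move: t0; rewrite -zt -xz' rx ltxx.
apply: (@le_trans _ _ (lam `]0, rho y])).
  have := lebesgue_measure_itv `]0, rho y]; rewrite /= lte_fin.
  have := normr_ge0 (f y - f x); rewrite -/(rho y) le_eqVlt => /predU1P[<-|->].
    by move=> _; exact: outer_measure_ge0.
  by rewrite sube0 => <-; exact: lexx.
apply: le_trans (le_outer_measure lam _ _ sub) _.
apply: le_trans (outer_measureU2 _ _ _) _.
rewrite -[leRHS]add0e; apply: leeD; first exact: lebesgue_outer_dist_null.
apply: lebesgue_outer_image => // z [/=]; rewrite !in_itv/= => /andP[xz zy] _; lra.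
Qed.

(** The function [w], which measures only the part off [C], still dominates the increments of [f];
    so the total variation, which is [mu ]a, b]], is at most the mass off [C]. *)
Lemma curve_measure_C : mu (`]a, b] `&` C) = 0%E.
Proof.
have mI x y : measurable (`]x, y] : set (measurableTypeR R)) by exact: measurable_itv.
have mC := measurable_C.
have fin x y : a <= x -> x <= y -> y <= b -> mu (`]x, y] `\` C) \is a fin_num.
  move=> ax xy yb; rewrite ge0_fin_numE//.
  apply: (@le_lt_trans _ _ (mu `]x, y])); last by rewrite curve_measure_itv// ltry.
  by apply: le_measure; rewrite ?inE//; exact: measurableD.
pose w s := fine (mu (`]a, s] `\` C)).
have : (norm_total_variation a b f <= (w b - w a)%:E)%E.
  apply: norm_total_variation_le => y z ay yz zb.
  rewrite -lee_fin; apply: (le_trans (dist_le_curve_measure ay yz zb)).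
  have [az yb] : a <= z /\ y <= b by lra.
  rewrite EFinB /w !fineK ?fin// leeBrDr ?fin//.
  rewrite -measureU; [|exact: measurableD|exact: measurableD|]; last first.
    rewrite -subset0 => t [[/= +  _] [/= + _]]; rewrite !in_itv/=; lra.
  apply: le_measure; rewrite ?inE; [by apply: measurableU; exact: measurableD|exact: measurableD|].
  move=> t [[/= + nC]|[/= + nC]]; rewrite !in_itv/= => h; split => //=; rewrite ?in_itv/=; lra.
have wa : w a = 0.
  by rewrite /w set_itv_ge ?bnd_simp ?ltxx// set0D measure0.
have finb := fin a b (lexx a) (ltW ab) (lexx b).
rewrite wa subr0 (norm_total_variationE fBV (lexx a) (ltW ab) (lexx b)).
rewrite -(curve_measure_itv (lexx a) (ltW ab) (lexx b)) /w fineK//.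
rewrite [X in (mu X <= _)%E -> _](_ : _ = (`]a, b] `&` C) `|` (`]a, b] `\` C)); last by rewrite setUIDK.
have mIC : measurable (`]a, b] `&` C : set (measurableTypeR R)) by exact: measurableI.
have mDC : measurable (`]a, b] `\` C : set (measurableTypeR R)) by exact: measurableD.
rewrite measureU//; last by rewrite -subset0 => t [[_ ?] []].
rewrite -[leRHS]add0e leeD2rE// => h.
by apply/eqP; rewrite eq_le h measure_ge0.
Qed.

End CriticalNull.

(** * Distance to a set *)

Section SetDistance.
Context {R : realType}.
Variable C : set R.
Hypothesis C0 : C !=set0.
Implicit Types (x y c : R).

Definition set_dist x := inf [set `|x - c| | c in C].

Let lb x : has_lbound [set `|x - c| | c in C].
Proof. by exists 0 => _ [c _ <-]; exact: normr_ge0. Qed.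

Let ne x : [set `|x - c| | c in C] !=set0.
Proof. by have [c Cc] := C0; exists `|x - c|, c. Qed.

Lemma set_dist_ge0 x : 0 <= set_dist x.
Proof. by apply: lb_le_inf => // _ [c _ <-]; exact: normr_ge0. Qed.

Lemma set_dist_in x : C x -> set_dist x = 0.
Proof.
move=> Cx; apply/eqP; rewrite eq_le set_dist_ge0 andbT.
by apply: (ge_inf (lb x)); exists x; rewrite // subrr normr0.
Qed.

Lemma set_dist_lip x y : set_dist x <= set_dist y + `|x - y|.
Proof.
rewrite -lerBlDr; apply: lb_le_inf => // _ [c Cc <-]; rewrite lerBlDr.
apply: (@le_trans _ _ `|x - c|); first by apply: (ge_inf (lb x)); exists c.
by have := ler_normD (y - c) (x - y); rewrite (_ : y - c + (x - y) = x - c)//; ring.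
Qed.

Lemma set_dist_gt0 x : closed C -> ~ C x -> 0 < set_dist x.
Proof.
move=> Cc nCx; have /closed_openC oC := Cc.
have /nbhs_ballP[d /= d0 dC] : nbhs x (~` C) by exact: open_nbhs_nbhs.
apply: (lt_le_trans d0); apply: lb_le_inf => // _ [c Cc' <-].
by rewrite leNgt; apply/negP => h; exact: (dC c h).
Qed.

Lemma set_dist_continuous : continuous set_dist.
Proof.
move=> x; apply/cvgrPdist_lt => e e0; apply/nbhs_ballP; exists e => //= y.
rewrite /ball/= => xy; apply: le_lt_trans xy.
have := set_dist_lip x y; have := set_dist_lip y x.
by rewrite (distrC y) ler_norml; lra.
Qed.

End SetDistance.

(* A modulus that is at least 2^-n on [r n, +oo[ and vanishes at 0. As an
   infimum of affine functions it is concave, hence continuous. *)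
Section ConcaveModulus.
Context {R : realType}.
Variable r : nat -> R.
Hypothesis r_gt0 : forall n, 0 < r n.
Hypothesis r_decr : forall n m, (n <= m)%N -> r m <= r n.
Hypothesis r_small : forall d, 0 < d -> exists n, r n <= d.
Implicit Types d e : R.

Definition modulus d := inf [set 2^-1 ^+ n + d / r n | n in [set: nat]].

Let pow_gt0 n : 0 < 2^-1 ^+ n :> R.
Proof. by rewrite exprn_gt0// invr_gt0. Qed.

Let lb d : 0 <= d -> has_lbound [set 2^-1 ^+ n + d / r n | n in [set: nat]].
Proof.
by move=> d0; exists 0 => _ [n _ <-]; rewrite addr_ge0 ?divr_ge0// ltW.
Qed.

Let ne d : [set 2^-1 ^+ n + d / r n | n in [set: nat]] !=set0.
Proof. by exists (2^-1 ^+ 0 + d / r 0%N), 0%N. Qed.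

Lemma modulus_le n d : 0 <= d -> modulus d <= 2^-1 ^+ n + d / r n.
Proof. by move=> d0; apply: (ge_inf (lb d0)); exists n. Qed.

Lemma modulus_ge0 d : 0 <= d -> 0 <= modulus d.
Proof.
by move=> d0; apply: lb_le_inf => // _ [n _ <-]; rewrite addr_ge0 ?divr_ge0// ltW.
Qed.

Lemma modulus0 : modulus 0 = 0.
Proof.
apply/eqP; rewrite eq_le modulus_ge0// andbT; apply/ler_addgt0Pr => e e0; rewrite add0r.
have [n ne_] : exists n, 2^-1 ^+ n <= e.
  have : (2^-1 ^+ n @[n --> \oo] --> (0 : R))%classic by apply: cvg_expr; rewrite ger0_norm//; lra.
  move=> /cvgrPdist_lt /(_ e e0)[n _ /(_ n (leqnn n))].
  by rewrite /= sub0r normrN ger0_norm ?(ltW (pow_gt0 _))// => /ltW; exists n.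
by apply: le_trans ne_; have := modulus_le n (lexx 0); rewrite mul0r addr0.
Qed.

(** For indices [k <= n] the constant term is already large enough; for [k > n] the linear term is
    at least 1. *)
Lemma modulus_ge n d : r n <= d -> 2^-1 ^+ n <= modulus d.
Proof.
move=> rd; have d0 : 0 < d := lt_le_trans (r_gt0 n) rd.
apply: lb_le_inf => // _ [k _ <-]; have [kn|nk] := leqP k n.
  apply: ler_wpDr; first by apply: divr_ge0; exact: ltW.
  by apply: ler_wiXn2l => //; rewrite invf_le1//; lra.
apply: ler_wpDl; first exact: ltW.
apply: (@le_trans _ _ 1); first by rewrite exprn_ile1//; lra.
by rewrite ler_pdivlMr// mul1r; apply: le_trans rd; apply: r_decr; exact: ltnW.
Qed.

Lemma modulus_gt0 d : 0 < d -> 0 < modulus d.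
Proof. by move=> /r_small[n rd]; apply: lt_le_trans (modulus_ge rd). Qed.

Lemma modulus_nd d e : 0 <= d -> d <= e -> modulus d <= modulus e.
Proof.
move=> d0 de; apply: lb_le_inf => // _ [n _ <-]; apply: (le_trans (modulus_le n d0)).
by rewrite lerD2l ler_pM2r// invr_gt0.
Qed.

(** The ratio of [modulus] to its argument decreases, since each affine function in the infimum has
    a positive value at 0. *)
Lemma modulus_concave d e : 0 <= d -> d <= e -> d * modulus e <= e * modulus d.
Proof.
move=> d0 de; have e0 := le_trans d0 de.
move: (e0); rewrite le_eqVlt => /predU1P[e00|e0'].
  by have -> : d = e by lra.
rewrite mulrC [leRHS]mulrC -ler_pdivrMr//.
apply: lb_le_inf => // _ [n _ <-].
rewrite ler_pdivrMr//; apply: le_trans (ler_wpM2r d0 (modulus_le n e0)) _.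
have := pow_gt0 n; set P := _ ^+ n => P0.
have -> : (P + e / r n) * d = P * d + e * d / r n by ring.
have -> : (P + d / r n) * e = P * e + e * d / r n by ring.
by rewrite lerD2r ler_pM2l.
Qed.

(** Monotonicity fixes the sign of the difference and concavity bounds it, with Lipschitz constant
    [modulus d / d]. *)
Lemma modulus_dist d e : 0 < d -> 0 <= e ->
  `|modulus e - modulus d| * d <= modulus d * `|e - d|.
Proof.
move=> d0 e0; have [de|/ltW ed] := leP d e.
  rewrite !ger0_norm ?subr_ge0//; last by apply: modulus_nd => //; exact: ltW.
  by have := modulus_concave (ltW d0) de; lra.
rewrite !ler0_norm ?subr_le0//; last exact: modulus_nd.
by have := modulus_concave e0 ed; lra.
Qed.

(** At 0 a single affine function with small constant term suffices; at [d > 0] the bound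
    [modulus_dist] applies. *)
Lemma modulus_cts d e : 0 <= d -> 0 < e -> exists2 t, 0 < t &
  forall d', 0 <= d' -> `|d' - d| < t -> `|modulus d' - modulus d| < e.
Proof.
rewrite le_eqVlt => /predU1P[<-|d0] e0.
  have [n ne_] : exists n, 2^-1 ^+ n < e / 2.
    have : (2^-1 ^+ n @[n --> \oo] --> (0 : R))%classic by apply: cvg_expr; rewrite ger0_norm//; lra.
    have e20 : 0 < e / 2 by lra.
    move=> /cvgrPdist_lt /(_ _ e20)[n _ /(_ n (leqnn n))].
    by rewrite /= sub0r normrN ger0_norm ?(ltW (pow_gt0 _))//; exists n.
  exists (r n * (e / 2)); first by rewrite mulr_gt0//; lra.
  move=> d' d'0; rewrite modulus0 !subr0 !ger0_norm ?modulus_ge0// => d'r.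
  apply: (le_lt_trans (modulus_le n d'0)).
  have : d' / r n < e / 2 by rewrite ltr_pdivrMr// mulrC.
  by move: ne_; set P := _ ^+ n; lra.
have M0 := modulus_gt0 d0.
exists (e * d / modulus d); first by rewrite divr_gt0// mulr_gt0.
move=> d' d'0; rewrite ltr_pdivlMr// mulrC => h.
by rewrite -(ltr_pM2r d0); apply: le_lt_trans (modulus_dist d0 d'0) h.
Qed.

End ConcaveModulus.

(** Makes radii that were chosen independently of each other nonincreasing. *)
Fixpoint running_min {R : realType} (s : nat -> R) n :=
  if n is n'.+1 then Num.min (running_min s n') (s n) else s 0%N.

Section RunningMin.
Context {R : realType}.
Variable s : nat -> R.

Lemma running_min_le n : running_min s n <= s n.
Proof. by case: n => //= n; rewrite ge_min lexx orbT. Qed.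

Lemma running_min_gt0 : (forall n, 0 < s n) -> forall n, 0 < running_min s n.
Proof. by move=> s0; elim=> //= n ih; rewrite lt_min ih s0. Qed.

Lemma running_min_decr n m : (n <= m)%N -> running_min s m <= running_min s n.
Proof.
move=> /subnK <-; elim: (m - n)%N => //= k; apply: le_trans.
by rewrite ge_min lexx.
Qed.

End RunningMin.

(** * A continuous weight vanishing exactly on [C], with integrable reciprocal *)

Section Weight.
Context {R : realType}.
Variables (mu : {measure set (measurableTypeR R) -> \bar R}) (a b : R) (C : set R).
Local Notation I := (`]a, b]%classic : set (measurableTypeR R)).
Hypothesis mu_fin : (mu I < +oo)%E.
Hypothesis Cclosed : closed C.
Hypothesis C0 : C !=set0.
Hypothesis muC : mu (I `&` C) = 0%E.
Implicit Types (x y e : R).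
Local Notation D := (set_dist C).

Definition thickening e : set (measurableTypeR R) := [set x | D x < e].

Lemma measurable_thickening e : measurable (thickening e).
Proof.
rewrite /thickening; apply: open_measurable; have -> : [set x | D x < e] = D @^-1` `]-oo, e[.
  by apply/seteqP; split => x /=; rewrite in_itv.
by apply: open_comp; [move=> x _; exact: set_dist_continuous|exact: interval_open].
Qed.

(** Continuity of a finite measure from above: as [C] is closed, the thickenings shrink to [C],
    which has measure 0. *)
Lemma dist_lt_small e : 0 < e -> exists k : nat,
  (mu (I `&` thickening k.+1%:R^-1) < e%:E)%E.
Proof.
move=> e0; pose F k : set (measurableTypeR R) := I `&` thickening k.+1%:R^-1.
have mI : measurable I by exact: measurable_itv.
have mF k : measurable (F k) by apply: measurableI => //; exact: measurable_thickening.
have FC : \bigcap_k F k = I `&` C.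
  apply/seteqP; split=> x => [Fx|[Ix Cx] k _].
    split; first by have [] := Fx 0%N Logic.I.
    apply: contrapT => /(set_dist_gt0 C0 Cclosed) Dx.
    have [k kx] : exists k : nat, k.+1%:R^-1 < D x.
      exists (Num.trunc (D x)^-1); rewrite -[ltRHS]invrK ltf_pV2 ?posrE ?invr_gt0//.
      exact: truncnS_gt.
    by have [_] := Fx k Logic.I; rewrite /thickening/= ltNge (ltW kx).
  by split => //; rewrite /thickening/= set_dist_in// invr_gt0.
have : mu \o F @ \oo --> mu (\bigcap_k F k).
  apply: nonincreasing_cvg_mu => //.
  - apply: le_lt_trans mu_fin; apply: le_measure; rewrite ?inE//; exact: subIsetl.
  - by rewrite FC; apply: measurableI => //; exact: closed_measurable.
  - move=> n m nm; apply/subsetPset => x [Ix]; rewrite /thickening/= => Dx; split => //=.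
    by apply: (lt_le_trans Dx); rewrite lef_pV2 ?posrE// ler_nat.
rewrite FC muC => /fine_cvgP[fin /cvgrPdist_lt /(_ e e0) small].
near \oo => k; exists k.
have kfin : mu (F k) \is a fin_num by near: k.
have : `|0 - (fine \o (mu \o F)) k| < e by near: k.
rewrite sub0r normrN /= ger0_norm ?fine_ge0// => h.
by rewrite -[ltLHS]fineK// lte_fin.
Unshelve. all: by end_near. Qed.

(** One factor of the bound on the measures absorbs the size [2 ^ n.+1] of the reciprocal weight on
    the thickening; the other one is summable. *)
Lemma radii : exists r : nat -> R, [/\ forall n, 0 < r n,
  forall n m, (n <= m)%N -> r m <= r n,
  forall d, 0 < d -> exists n, r n <= d &
  forall n, (mu (I `&` thickening (r n)) <= (1 / (2 ^ n.+1)%:R / (2 ^ n.+1)%:R)%:E)%E].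
Proof.
have step (n : nat) : exists s : R, [/\ 0 < s, s <= n.+1%:R^-1 &
    (mu (I `&` thickening s) <= (1 / (2 ^ n.+1)%:R / (2 ^ n.+1)%:R)%:E)%E].
  have p0 : 0 < 1 / (2 ^ n.+1)%:R / (2 ^ n.+1)%:R :> R by rewrite !divr_gt0// ltr0n expn_gt0.
  have [k kp] := dist_lt_small p0.
  exists (Num.min k.+1%:R^-1 n.+1%:R^-1); split.
  - by rewrite lt_min !invr_gt0 !ltr0n.
  - by rewrite ge_min lexx orbT.
  - apply: le_trans (ltW kp); apply: le_measure; rewrite ?inE.
    + by apply: measurableI; [exact: measurable_itv|exact: measurable_thickening].
    + by apply: measurableI; [exact: measurable_itv|exact: measurable_thickening].
    + by move=> x [Ix]; rewrite /thickening/= lt_min => /andP[Dx _].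
have [s sP] := choice step.
exists (running_min s); split.
- by apply: running_min_gt0 => n; have [] := sP n.
- exact: running_min_decr.
- move=> d d0; exists (Num.trunc d^-1); apply: (le_trans (running_min_le _ _)).
  have [_ sn _] := sP (Num.trunc d^-1); apply: (le_trans sn).
  rewrite -[leRHS]invrK lef_pV2 ?posrE ?invr_gt0//.
  by apply: ltW; exact: truncnS_gt.
- move=> n; have [_ _ sn] := sP n; apply: le_trans sn; apply: le_measure; rewrite ?inE.
  + by apply: measurableI; [exact: measurable_itv|exact: measurable_thickening].
  + by apply: measurableI; [exact: measurable_itv|exact: measurable_thickening].
  + by move=> x [Ix Dx]; split => //; apply: (lt_le_trans Dx); exact: running_min_le.
Qed.

Lemma exists_weight : exists p : R -> R,
  [/\ continuous p, forall x, C x -> p x = 0, forall x, ~ C x -> 0 < p x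
    & (\int[mu]_(x in I) ((p x)^-1)%:E < +oo)%E].
Proof.
have [r [r0 rdecr rsmall rmu]] := radii.
pose p x := modulus r (D x).
have D0 := set_dist_ge0 C0.
have pcont : continuous p.
  move=> x; apply/cvgrPdist_lt => e e0.
  have [t t0 mt] := modulus_cts r0 rdecr rsmall (D0 x) e0.
  have := (set_dist_continuous C0 (x := x)); move=> /cvgrPdist_lt /(_ t t0).
  by apply: filterS => y; rewrite distrC => h; rewrite distrC; exact: mt.
have pC x : C x -> p x = 0 by move=> Cx; rewrite /p (set_dist_in C0 Cx); exact: modulus0.
have pNC x : ~ C x -> 0 < p x.
  by move=> nCx; apply: modulus_gt0 => //; exact: set_dist_gt0.
exists p; split => //.
have p_ge0 x : 0 <= p x by exact: modulus_ge0.
have mI : measurable I by exact: measurable_itv.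
pose G n : set (measurableTypeR R) := thickening (r n).
have mG n : measurable (G n) by exact: measurable_thickening.
(* The reciprocal of [p] is bounded by 1 plus the sum of the [h n], and [h n] has integral at most
   [1 / 2 ^ n.+1]. *)
pose h n (x : measurableTypeR R) : \bar R := ((2 ^ n.+1)%:R%:E * (\1_(G n) x)%:E)%E.
have h0 n x : (0 <= h n x)%E by rewrite mule_ge0// lee_fin.
have mh n : measurable_fun I (h n).
  apply: emeasurable_funM => //; apply/measurable_EFinP; exact: measurable_indic.
have mq : measurable_fun I (fun x : measurableTypeR R => ((p x)^-1)%:E).
  apply/measurable_EFinP; rewrite (_ : (fun _ => _) = (fun x => p x `^ (-1))); last first.
    by apply/funext => x; rewrite powR_inv1.
  apply: (measurableT_comp (measurable_powR (-1))).
  by apply: measurable_funTS; exact: continuous_measurable_fun.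
have mS : measurable_fun I (fun x => \sum_(0 <= n <oo) h n x)%E.
  by apply: (ge0_emeasurable_sum (P := xpredT)) => // n x _ _.
have le x : I x -> (((p x)^-1)%:E <= 1 + \sum_(0 <= n <oo) h n x)%E.
  move=> Ix; have S0 : (0 <= \sum_(0 <= n <oo) h n x)%E by exact: nneseries_ge0.
  have [Cx|nCx] := pselect (C x).
    (* On [C] the integrand is 0, by the convention for the inverse of 0. *)
    by rewrite pC// invr0 adde_ge0.
  have Dx := set_dist_gt0 C0 Cclosed nCx.
  have ex : exists n, r n <= D x by exact: rsmall.
  (* If [N.+1] is the first index with [r N.+1 <= D x], then [x] lies in [G N] and [p x] is at least
     [2^-1 ^+ N.+1]; if the first index is 0, then [p x >= 1]. *)
  case: (ex_minnP ex) => -[|N] rN Nmin.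
    apply: (@le_trans _ _ 1%E); last by rewrite leeDl.
    rewrite lee_fin invf_le1 ?pNC//; have := modulus_ge r0 rdecr rN.
    by rewrite expr0.
  apply: (@le_trans _ _ (h N x)).
    rewrite /h indicE mem_set; last first.
      by rewrite /G/thickening/= ltNge; apply/negP => /Nmin; rewrite ltnn.
    rewrite mule1 lee_fin natrX -[leRHS]invrK -exprVn lef_pV2 ?posrE ?pNC//.
    exact: modulus_ge.
  apply: (@le_trans _ _ (\sum_(0 <= n <oo) h n x)%E); last by rewrite leeDr.
  apply: le_trans (nneseries_lim_ge N.+1 _) => //.
  by rewrite big_nat_recr//= leeDr// sume_ge0.
apply: (le_lt_trans (ge0_le_integral mu mI _ mq _ le)).
- by move=> x _; rewrite lee_fin invr_ge0.
- by apply: emeasurable_funD.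
rewrite ge0_integralD//; last by move=> x _; exact: nneseries_ge0.
rewrite integral_cst// mul1e integral_nneseries//.
apply: lte_add_pinfty => //.
apply: (@le_lt_trans _ _ (\sum_(0 <= n <oo) (1 / (2 ^ n.+1)%:R)%:E)%E); last first.
  by apply: (le_lt_trans (epsilon_trick0 xpredT ler01)); rewrite ltry.
apply: lee_nneseries => [n _ _|n _]; first exact: integral_ge0.
rewrite /h ge0_integralZl_EFin//; last first.
  by apply/measurable_EFinP; exact: measurable_indic.
rewrite integral_indic// setIC.
apply: le_trans (lee_wpmul2l _ (rmu n)) _ => //.
by rewrite -EFinM lee_fin mulrC divfK// pnatr_eq0 -lt0n expn_gt0.
Qed.

End Weight.

(** * The time change and its slope bounds *)

Section TimeChange.
Context {R : realType}.
Variables (mu : {measure set (measurableTypeR R) -> \bar R}).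
Variables (a b : R) (v p : R -> R) (C : set R).
Local Notation oc x y := (`]x, y]%classic : set (measurableTypeR R)).
Hypothesis ab : a < b.
Hypothesis mu_itv : forall x y, a <= x -> x <= y -> y <= b ->
  mu (oc x y) = (v y - v x)%:E.
Hypothesis v_cts : forall x e, x \in `[a, b] -> 0 < e -> exists2 d, 0 < d &
  forall y, y \in `[a, b] -> `|y - x| < d -> `|v y - v x| < e.
Hypothesis Cclosed : closed C.
Hypothesis muC : mu (oc a b `&` C) = 0%E.
Hypothesis pcont : continuous p.
Hypothesis pC : forall x, C x -> p x = 0.
Hypothesis pNC : forall x, ~ C x -> 0 < p x.
Hypothesis p_int : (\int[mu]_(x in oc a b) ((p x)^-1)%:E < +oo)%E.
Hypothesis Cflat : forall x y, a <= x -> x < y -> y <= b -> v x = v y ->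
  forall z, x < z -> z < y -> C z.
Implicit Types (x y z e m M : R).

Let mI x y : measurable (oc x y). Proof. exact: measurable_itv. Qed.
Let mC : measurable (C : set (measurableTypeR R)).
Proof. exact: closed_measurable. Qed.

Let p_ge0 x : 0 <= p x.
Proof. by have [/pC->|/pNC/ltW] := pselect (C x). Qed.

Let mq (A : set (measurableTypeR R)) :
  measurable_fun A (fun x : measurableTypeR R => ((p x)^-1)%:E).
Proof.
apply/measurable_EFinP; rewrite (_ : (fun _ => _) = (fun x => p x `^ (-1))); last first.
  by apply/funext => x; rewrite powR_inv1.
apply: (measurableT_comp (measurable_powR (-1))).
by apply: measurable_funTS; exact: continuous_measurable_fun.
Qed.

Let q_ge0 x : (0 <= ((p x)^-1)%:E)%E.
Proof. by rewrite lee_fin invr_ge0. Qed.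

Let wint x y := (\int[mu]_(z in oc x y) ((p z)^-1)%:E)%E.
Let Clen x y := lebesgue_measure (oc x y `&` C).

Let wint_fin x y : a <= x -> x <= y -> y <= b -> wint x y \is a fin_num.
Proof.
move=> ax xy yb; rewrite ge0_fin_numE; last exact: integral_ge0.
apply: le_lt_trans p_int; apply: ge0_subset_integral => //.
by move=> z /=; rewrite !in_itv/= => /andP[? ?]; lra.
Qed.

Let Clen_le x y : x <= y -> (Clen x y <= (y - x)%:E)%E.
Proof.
move=> xy; apply: (@le_trans _ _ (lebesgue_measure (oc x y))).
  by apply: le_measure; rewrite ?inE//; exact: measurableI.
rewrite lebesgue_measure_itv/= lte_fin; case: ifPn => // _.
by rewrite lee_fin subr_ge0.
Qed.

Let Clen_fin x y : x <= y -> Clen x y \is a fin_num.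
Proof.
by move=> xy; rewrite ge0_fin_numE// (le_lt_trans (Clen_le xy))// ltry.
Qed.

(** The Lebesgue term gives positive length to the intervals contained in [C], which have no
    [mu]-mass; this makes [time] strictly increasing. *)
Definition time_length x y : R := fine (wint x y) + fine (Clen x y).

Lemma time_lengthD x y z : a <= x -> x <= y -> y <= z -> z <= b ->
  time_length x z = time_length x y + time_length y z.
Proof.
move=> ax xy yz zb; rewrite /time_length.
have xz := le_trans xy yz; have ay := le_trans ax xy; have yb := le_trans yz zb.
have xzU : oc x z = oc x y `|` oc y z.
  apply/seteqP; split=> t /=; rewrite !in_itv/=.
    by move=> /andP[xt tz]; have [ty|yt] := leP t y; [left|right]; lra.
  by move=> [|] /andP[? ?]; lra.
have dis : [disjoint oc x y & oc y z].
  apply/disj_set2P; rewrite -subset0 => t [/=]; rewrite !in_itv/= => /andP[? ?] /andP[? ?]; lra.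
have -> : wint x z = (wint x y + wint y z)%E.
  by rewrite /wint xzU ge0_integral_setU.
have -> : Clen x z = (Clen x y + Clen y z)%E.
  rewrite /Clen xzU setIUl measureU//; [exact: measurableI|exact: measurableI|].
  by move/disj_set2P : dis; rewrite setIACA => ->; rewrite set0I.
rewrite (fineD (wint_fin ax xy yb) (wint_fin ay yz zb)) (fineD (Clen_fin xy) (Clen_fin yz)).
ring.
Qed.

Definition time x := time_length a x.

Lemma timeB x y : a <= x -> x <= y -> y <= b -> time y - time x = time_length x y.
Proof. by move=> ax xy yb; rewrite /time (@time_lengthD a x y)//; ring. Qed.

Lemma time_length_ge0 x y : 0 <= time_length x y.
Proof.
by rewrite addr_ge0// fine_ge0//; exact: integral_ge0.
Qed.

(** Off [C], which carries all of the mass, the integrand is at least the inverse of [M]. *)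
Lemma time_length_ge x y M : a <= x -> x <= y -> y <= b -> 0 < M ->
  (forall z, x <= z -> z <= y -> p z <= M) -> v y - v x <= M * time_length x y.
Proof.
move=> ax xy yb M0 pM.
have mD : measurable (oc x y `\` C) by exact: measurableD.
have muD : mu (oc x y `\` C) = (v y - v x)%:E.
  have mIC : measurable (oc x y `&` C) by exact: measurableI.
  have muIC : mu (oc x y `&` C) = 0%E.
    apply/eqP; rewrite eq_le measure_ge0 andbT -muC.
    apply: le_measure; rewrite ?inE//; first exact: measurableI.
    by move=> z [/=]; rewrite !in_itv/= => /andP[? ?] ?; split => //=; rewrite ?in_itv/=; lra.
  rewrite -(mu_itv ax xy yb) -[LHS]add0e -muIC -measureU ?setUIDK//.
  by rewrite -subset0 => t [[_ ?] []].
have h : ((M^-1 * (v y - v x))%:E <= wint x y)%E.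
  apply: (@le_trans _ _ (\int[mu]_(z in oc x y `\` C) ((p z)^-1)%:E)%E); last first.
    by apply: ge0_subset_integral => //.
  rewrite EFinM -muD -integral_cst//; apply: ge0_le_integral => //.
  - by move=> z _; rewrite lee_fin invr_ge0 ltW.
  - move=> z [/=]; rewrite in_itv/= => /andP[xz zy] nCz.
    by rewrite lee_fin lef_pV2 ?posrE ?pNC//; apply: pM => //; exact: ltW.
have : M^-1 * (v y - v x) <= time_length x y.
  apply: (@le_trans _ _ (fine (wint x y))).
    by rewrite -lee_fin fineK// wint_fin.
  by rewrite /time_length lerDl fine_ge0// measure_ge0.
by rewrite ler_pdivrMl.
Qed.

(** If [m > 0], the interval does not meet [C], so the Lebesgue term is 0 and the integrand is at
    most the inverse of [m]; otherwise the signs decide. *)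
Lemma time_length_le x y m : a <= x -> x <= y -> y <= b ->
  (forall z, x <= z -> z <= y -> m <= p z) -> m * time_length x y <= v y - v x.
Proof.
move=> ax xy yb pm.
have vxy : 0 <= v y - v x by rewrite -lee_fin -mu_itv.
have [m0|m0] := leP m 0.
  by apply: le_trans vxy; apply: mulr_le0_ge0 => //; exact: time_length_ge0.
have C0 : oc x y `&` C = set0.
  rewrite -subset0 => z [/=]; rewrite in_itv/= => /andP[xz zy] /pC pz.
  by have := pm z (ltW xz) zy; rewrite pz; lra.
have h : (wint x y <= (m^-1 * (v y - v x))%:E)%E.
  rewrite EFinM -(mu_itv ax xy yb) -integral_cst//; apply: ge0_le_integral => //.
  move=> z /=; rewrite in_itv/= => /andP[xz zy].
  have pz := pm z (ltW xz) zy.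
  by rewrite lee_fin lef_pV2 ?posrE// (lt_le_trans m0).
rewrite /time_length /Clen C0 measure0 addr0 mulrC -ler_pdivlMr// mulrC.
by rewrite -lee_fin fineK// wint_fin.
Qed.

(** If [v] is constant there, the open interval lies in [C] and the Lebesgue term is at least
    [y - x]. Otherwise the increment of [v] is positive and [time_length_ge] applies with a bound of
    [p]. *)
Lemma time_length_gt0 x y : a <= x -> x < y -> y <= b -> 0 < time_length x y.
Proof.
move=> ax xy yb; have vxy : 0 <= v y - v x by rewrite -lee_fin -mu_itv// ltW.
move: vxy; rewrite le_eqVlt => /predU1P[vxy|vxy].
  have vE : v x = v y by lra.
  have h : ((y - x)%:E <= Clen x y)%E.
    apply: (@le_trans _ _ (lebesgue_measure (`]x, y[%classic : set (measurableTypeR R)))).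
      by rewrite lebesgue_measure_itv/= lte_fin xy.
    apply: le_measure; rewrite ?inE; [exact: measurable_itv|exact: measurableI|].
    move=> z /=; rewrite in_itv/= => /andP[xz zy]; split.
      by rewrite /= in_itv/= xz ltW.
    exact: (Cflat ax xy yb vE).
  rewrite /time_length; apply: (@lt_le_trans _ _ (y - x)); first lra.
  apply: (@le_trans _ _ (fine (Clen x y))); last by rewrite lerDr fine_ge0//; exact: integral_ge0.
  by rewrite -lee_fin fineK// Clen_fin// ltW.
have pcxy : {within `[x, y], continuous p} by exact: continuous_subspaceT.
have [c _ pc] := EVT_max (ltW xy) pcxy.
have M0 : 0 < p c + 1 by have := p_ge0 c; lra.
have : v y - v x <= (p c + 1) * time_length x y.
  apply: time_length_ge => //; first exact: ltW.
  by move=> z xz zy; have := pc z; rewrite in_itv/= xz zy => /(_ isT); lra.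
by move=> h; rewrite -(pmulr_rgt0 _ M0); apply: lt_le_trans h.
Qed.

(** Absolute continuity of the integral handles the first term, as [v] is continuous; the second is
    at most the length of the interval. *)
Lemma time_cts x e : x \in `[a, b] -> 0 < e -> exists2 d, 0 < d &
  forall y, y \in `[a, b] -> `|y - x| < d -> `|time y - time x| < e.
Proof.
move=> xab e0; have e20 : 0 < e / 2 by lra.
pose q0 (z : measurableTypeR R) : R := (((fun z => (p z)^-1) : measurableTypeR R -> R) \_ (oc a b)) z.
have q0E : EFin \o q0 = (fun z => ((p z)^-1)%:E) \_ (oc a b).
  by apply/funext => z /=; rewrite /q0 /patch; case: ifP.
have intq : mu.-integrable setT (EFin \o q0).
  apply/integrableP; rewrite q0E; split.
    by apply/(measurable_restrictT _ (mI a b)).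
  rewrite (eq_integral ((fun z => ((p z)^-1)%:E) \_ (oc a b))); last first.
    by move=> z _; rewrite gee0_abs// /patch; case: ifP.
  by rewrite -integral_mkcond.
have [t [t0 small]] := integral_normr_continuous intq e20.
have [d1 d10 vd] := v_cts xab t0.
have d0 : 0 < Num.min d1 (e / 2) by rewrite lt_min d10.
have key y z : a <= y -> y <= z -> z <= b -> v z - v y < t -> z - y < e / 2 ->
    time_length y z < e.
  move=> ay yz zb vt ze.
  have : fine (wint y z) < e / 2.
    have := small (oc y z) (mI y z); rewrite mu_itv// lte_fin => /(_ vt).
    apply: le_lt_trans; rewrite /Rintegral.
    rewrite (_ : (\int[mu]_(w in oc y z) (`|q0 w|)%:E)%E = wint y z)//.
    apply: eq_integral => w; rewrite inE/= in_itv/= => /andP[yw wz].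
    rewrite /q0 /patch mem_set/=; last by rewrite in_itv/=; lra.
    by rewrite ger0_norm// invr_ge0.
  have : fine (Clen y z) <= z - y.
    by rewrite -lee_fin fineK ?Clen_fin// Clen_le.
  by rewrite /time_length; lra.
exists (Num.min d1 (e / 2)) => // y yab; rewrite lt_min => /andP[yd1 ye].
have := vd y yab yd1; move: xab yab; rewrite !in_itv/= => /andP[ax xb] /andP[ay yb].
move: ye; rewrite !ltr_norml => /andP[ye1 ye2] /andP[vt1 vt2].
have [xy|/ltW yx] := leP x y.
  have := time_length_ge0 x y; have := key x y ax xy yb; rewrite timeB//; lra.
have := time_length_ge0 y x; have := key y x ay yx xb; rewrite -timeB//; lra.
Qed.

End TimeChange.

(* With phi the arc length of g, differentiability of phi at t together with the
   asymptotic equality of chord and arc for pairs straddling t controls pairs on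
   one side of t through the reverse triangle inequality. *)
Lemma md_approx_arclength (R : realType) (X : normedModType R) (a b t P : R)
    (g : R -> X) (phi : R -> R) :
  t \in `[a, b] ->
  0 <= P ->
  (forall y z, a <= y -> y <= z -> z <= b -> `|g z - g y| <= phi z - phi y) ->
  (forall e, 0 < e -> exists2 d, 0 < d & forall y z,
    a <= y -> y <= z -> z <= b -> `|y - t| < d -> `|z - t| < d ->
    `|phi z - phi y - P * (z - y)| <= e * (z - y)) ->
  (0 < P -> forall e, 0 < e -> exists2 d, 0 < d & forall y z,
    a <= y -> y <= t -> t <= z -> z <= b -> t - d < y -> z < t + d ->
    (1 - e) * (phi z - phi y) <= `|g z - g y|) ->
  md_approx a b g t P.
Proof.
rewrite in_itv/= => /andP[at_ tb] P0 gphi dphi greg e e0.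
have e20 : 0 < e / 2 by lra.
have Pe : 0 < P + e / 2 by lra.
(* Near [t] the slope of [phi] is at most [P + e / 2], so a relative error [eta] in the arc costs at
   most [e / 2] per unit of time. *)
pose eta := e / 2 / (P + e / 2).
have eta0 : 0 < eta by rewrite divr_gt0.
have etaE : eta * (P + e / 2) = e / 2 by rewrite /eta divfK// gt_eqF.
have [d1 d10 phid] := dphi _ e20.
have [d2 d20 gd] : exists2 d, 0 < d & forall y z, a <= y -> y <= z -> z <= b ->
    `|y - t| < d -> `|z - t| < d ->
    P * (z - y) - e * (`|y - t| + `|z - t|) <= `|g z - g y|.
  move: P0; rewrite le_eqVlt => /predU1P[<-|P0].
    exists 1 => // y z _ _ _ _ _; rewrite mul0r.
    have := normr_ge0 (g z - g y); have := normr_ge0 (y - t); have := normr_ge0 (z - t); nra.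
  have [d2 d20 gd2] := greg P0 eta eta0.
  exists (Num.min d1 d2); first by rewrite lt_min d10.
  move=> y z ay yz zb; rewrite !lt_min => /andP[yd1 yd2] /andP[zd1 zd2].
  have bound p q : a <= p -> p <= q -> q <= b -> `|p - t| < d1 -> `|q - t| < d1 ->
      eta * (phi q - phi p) <= e / 2 * (q - p).
    move=> ap pq qb pd qd; have := phid p q ap pq qb pd qd; rewrite ler_norml => /andP[_ h].
    apply: (@le_trans _ _ (eta * ((P + e / 2) * (q - p)))).
      by rewrite ler_pM2l//; lra.
    by rewrite mulrA etaE.
  have td : `|t - t| < d1 by rewrite subrr normr0.
  have := phid y z ay yz zb yd1 zd1; rewrite ler_norml => /andP[lo _].
  move: (yd2) (zd2); rewrite !ltr_norml => /andP[y1 y2] /andP[z1 z2].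
  have [yt|/ltW ty] := leP y t; have [tz|/ltW zt] := leP t z.
  - have := gd2 y z ay yt tz zb; have := bound y z ay yz zb yd1 zd1.
    rewrite [`|z - t|]ger0_norm ?subr_ge0// [`|y - t|]ler0_norm ?subr_le0//.
    rewrite mulrBl mul1r; lra.
  - have := gd2 y t ay yt (lexx t) tb; have := bound y t ay yt tb yd1 td.
    have := gphi z t (le_trans ay yz) zt tb; have := ler_normD (g t - g z) (g z - g y).
    rewrite addrA subrK [`|z - t|]ler0_norm ?subr_le0// [`|y - t|]ler0_norm ?subr_le0// mulrBl mul1r; nra.
  - have := gd2 t z at_ (lexx t) tz zb; have := bound t z at_ tz zb td zd1.
    have := gphi t y at_ ty (le_trans yz zb); have := ler_normD (g z - g y) (g y - g t).
    rewrite addrA subrK [`|z - t|]ger0_norm ?subr_ge0// [`|y - t|]ger0_norm ?subr_ge0// mulrBl mul1r; nra.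
  - have -> : z = t by lra.
    have -> : y = t by lra.
    by rewrite !subrr normr0 mulr0 addr0 mulr0 subr0.
exists (Num.min d1 d2); first by rewrite lt_min d10.
have key y z : a <= y -> y <= z -> z <= b -> `|y - t| < Num.min d1 d2 ->
    `|z - t| < Num.min d1 d2 ->
    `| `|g z - g y| - P * (z - y)| <= e * (`|y - t| + `|z - t|).
  move=> ay yz zb; rewrite !lt_min => /andP[yd1 yd2] /andP[zd1 zd2].
  have := gd y z ay yz zb yd2 zd2; have := gphi y z ay yz zb.
  have := phid y z ay yz zb yd1 zd1; rewrite !ler_norml => /andP[_ up].
  have : z - y <= `|y - t| + `|z - t|.
    by have := ler_norm (z - t); have := ler_norm (t - y); rewrite (distrC t y); lra.
  move=> h h1 h2; apply/andP; split; first by lra.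
  have : e / 2 * (z - y) <= e * (`|y - t| + `|z - t|) by nra.
  lra.
move=> y z; rewrite !in_itv/= => /andP[ay yb] /andP[az zb] yd zd.
have [yz|/ltW zy] := leP y z.
  rewrite [`|g y - g z|]distrC [`|y - z|]distrC [`|z - y|]ger0_norm ?subr_ge0//; exact: key.
rewrite [`|y - z|]ger0_norm ?subr_ge0// [`|y - t| + _]addrC; exact: key.
Qed.

(** * The closed set of irregular points *)

Section RegularSet.
Context {R : realType} {X : normedModType R}.
Variables (a b : R) (f : R -> X).
Hypothesis ab : a < b.
Hypothesis fcont : {within `[a, b], continuous f}.
Implicit Types (x y z d e : R).

Definition regular_interior : set R := [set x | exists d : R,
  [/\ 0 < d, `]x - d, x + d[ `<=` `[a, b]
    & forall y, y \in `]x - d, x + d[ -> bilaterally_metrically_regular a b f y]].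

(** Contains [Mb a b f], and in addition the points around which [f] is constant. *)
Definition irregular_set : set R := `[a, b] `\` regular_interior.

Lemma regular_interior_regular x : regular_interior x ->
  bilaterally_metrically_regular a b f x.
Proof. by move=> [d [d0 _]]; apply; rewrite in_itv/=; lra. Qed.

Lemma itv_sub_bounds x d : 0 < d -> `]x - d, x + d[ `<=` `[a, b] ->
  a <= x - d /\ x + d <= b.
Proof.
move=> d0 sub; split.
  rewrite leNgt; apply/negP => h.
  (* If [x - d < a], the midpoint of the two lies below [a]; the minimum with [x] keeps it below
     [x + d]. *)
  pose w := Num.min x ((a + (x - d)) / 2).
  have w1 : w <= x by rewrite /w ge_min lexx.
  have w2 : w <= (a + (x - d)) / 2 by rewrite /w ge_min lexx orbT.
  have w3 : x - d < w by rewrite /w lt_min; apply/andP; split; lra.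
  by have /= := sub w; rewrite !in_itv/= => /(_ _)/andP[|]; lra.
rewrite leNgt; apply/negP => h.
pose w := Num.max x ((b + (x + d)) / 2).
have w1 : x <= w by rewrite /w le_max lexx.
have w2 : (b + (x + d)) / 2 <= w by rewrite /w le_max lexx orbT.
have w3 : w < x + d by rewrite /w gt_max; apply/andP; split; lra.
by have /= := sub w; rewrite !in_itv/= => /(_ _)/andP[|]; lra.
Qed.

Lemma regular_interior_open : open regular_interior.
Proof.
rewrite openE => x [d [d0 sub reg]]; apply/nbhs_ballP; exists (d / 2) => /=; first lra.
move=> y; rewrite /ball/= ltr_norml => /andP[y1 y2]; exists (d / 2); split; first lra.
  by move=> z /=; rewrite !in_itv/= => /andP[z1 z2]; have := sub z; rewrite /= !in_itv/=; apply; lra.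
by move=> z; rewrite in_itv/= => /andP[z1 z2]; apply: reg; rewrite in_itv/=; lra.
Qed.

Lemma irregular_set_closed : closed irregular_set.
Proof.
apply: closedI; first exact: interval_closed.
exact/open_closedC/regular_interior_open.
Qed.

Lemma irregular_set_left : irregular_set a.
Proof.
split; first by rewrite /= in_itv/= lexx ltW.
by move=> [d [d0 /(itv_sub_bounds d0)[]]]; lra.
Qed.

(** If [f y = f x], the quotient is 0, at distance 1 from its limit. *)
Lemma regular_neq x : bilaterally_metrically_regular a b f x -> a <= x ->
  exists2 d, 0 < d & forall y, x < y -> y <= b -> y < x + d -> f y <> f x.
Proof.
move=> /bilaterally_metrically_regularP/(_ 1 ltr01)[d d0 fd] ax; exists d => // y xy yb yd fyx.
have xd : x - d < x by lra.
have := fd x y (And4 ax (lexx x) (ltW xy) yb) xy xd yd.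
by rewrite fyx subrr normr0 mul0r subr0 normr1 ltxx.
Qed.

(** An irregular point outside [Mb a b f] lies in an interval of constancy of [f], whose left end
    [y0] has the same image and belongs to [Mb a b f]. *)
Lemma image_irregular_set : f @` irregular_set `<=` f @` Mb a b f.
Proof.
move=> _ [x [xab xreg] <-].
have [xM|xM] := pselect (Mb a b f x); first by exists x.
have [d [d0 sub [[c fc]|reg]]] : exists delta : R,
    [/\ 0 < delta, `]x - delta, x + delta[ `<=` `[a, b] &
     (exists c : X, forall y : R, y \in `]x - delta, x + delta[ -> f y = c) \/
     (forall y : R, y \in `]x - delta, x + delta[ -> bilaterally_metrically_regular a b f y)];
  last 1 first.
- by exfalso; apply: xreg; exists d.
- by apply: contrapT => h; apply: xM; split.
have [adx xdb] := itv_sub_bounds d0 sub.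
pose S := [set y | a <= y /\ forall z, y <= z -> z <= x -> f z = f x].
have Slb : has_lbound S by exists a => y [].
have Sx : S (x - d / 2).
  split; first lra; move=> z z1 z2.
  by rewrite (fc z) ?(fc x)// in_itv/=; lra.
have Sinf : has_inf S by split => //; exists (x - d / 2).
pose y0 := inf S.
have y0x : y0 <= x - d / 2 by exact: ge_inf.
have ay0 : a <= y0 by apply: lb_le_inf; [exists (x - d / 2)|move=> y []].
have y0ab : y0 \in `[a, b] by rewrite in_itv/=; lra.
have fright z : y0 < z -> z <= x -> f z = f x.
  move=> yz zx; have zy0 : 0 < z - y0 by lra.
  have [s [_ Ss] sz] := inf_adherent zy0 Sinf.
  by apply: Ss => //; rewrite -/y0 in sz; lra.
have fy0 : f y0 = f x.
  apply/eqP; rewrite -subr_eq0 -normr_le0; apply/ler_addgt0Pr => e e0; rewrite add0r.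
  have [r r0 fr] := (within_itv_continuousP a b f).1 fcont y0 y0ab e e0.
  pose z := Num.min x (y0 + r / 2).
  have z1 : z <= x by rewrite /z ge_min lexx.
  have z2 : z <= y0 + r / 2 by rewrite /z ge_min lexx orbT.
  have z3 : y0 < z by rewrite /z lt_min; apply/andP; split; lra.
  rewrite -(fright z)// distrC ltW//; apply: fr; first by rewrite in_itv/=; lra.
  by rewrite ltr_norml; lra.
(* Constancy around [y0] would extend the interval to the left of its infimum; regularity at [y0]
   contradicts the constancy on its right. *)
exists y0 => //; split => // -[d' [d'0 sub' [[c' fc']|reg']]].
  have [ad' _] := itv_sub_bounds d'0 sub'.
  have : S (y0 - d' / 2).
    split; first lra; move=> z z1 z2.
    have [zy|yz] := leP z y0; last exact: fright.
    by rewrite -fy0 !fc'// in_itv/=; lra.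
  by move=> /(ge_inf Slb); rewrite -/y0; lra.
have [r r0 neq] : exists2 d, 0 < d & forall y, y0 < y -> y <= b -> y < y0 + d -> f y <> f y0.
  by apply: regular_neq => //; apply: reg'; rewrite in_itv/=; lra.
pose z := Num.min x (y0 + r / 2).
have z1 : z <= x by rewrite /z ge_min lexx.
have z2 : z <= y0 + r / 2 by rewrite /z ge_min lexx orbT.
have z3 : y0 < z by rewrite /z lt_min; apply/andP; split; lra.
by apply: (neq z); rewrite ?fy0 ?fright//; lra.
Qed.

Hypothesis fBV : (norm_total_variation a b f < +oo)%E.

(** Where [v] is constant so is [f], which [regular_neq] excludes near a regular point. *)
Lemma irregular_set_flat x y : a <= x -> x < y -> y <= b ->
  variation_fun a f x = variation_fun a f y ->
  forall z, x < z -> z < y -> irregular_set z.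
Proof.
move=> ax xy yb vxy z xz zy; split; first by rewrite /= in_itv/=; lra.
have az : a <= z by lra.
move=> /regular_interior_regular/regular_neq/(_ az)[r r0 neq].
pose w := Num.min y (z + r / 2).
have w1 : w <= y by rewrite /w ge_min lexx.
have w2 : w <= z + r / 2 by rewrite /w ge_min lexx orbT.
have w3 : z < w by rewrite /w lt_min; apply/andP; split; lra.
have wb : w <= b by lra.
apply: (neq w) => //; first lra.
apply/eqP; rewrite -subr_eq0 -normr_le0.
have := variation_fun_dist fBV az (ltW w3) wb.
have := variation_fun_le fBV ax (ltW xz) (ltW (lt_le_trans w3 wb)).
by have := variation_fun_le fBV (le_trans az (ltW w3)) w1 yb; lra.
Qed.

(** Regularity without division, so that pairs with [y = z] are included. *)
Lemma regular_chord x e : a <= x -> x <= b ->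
  bilaterally_metrically_regular a b f x -> 0 < e ->
  exists2 d, 0 < d & forall y z, a <= y -> y <= x -> x <= z -> z <= b ->
    x - d < y -> z < x + d ->
    (1 - e) * (variation_fun a f z - variation_fun a f y) <= `|f z - f y|.
Proof.
move=> ax xb /bilaterally_metrically_regularP reg e0; have [d d0 fd] := reg e e0.
exists d => // y z ay yx xz zb yd zd.
have yz := le_trans yx xz.
move: (yz); rewrite le_eqVlt => /predU1P[<-|yz'].
  by rewrite !subrr mulr0 normr0.
have := fd y z (And4 ay yx xz zb) yz' yd zd.
rewrite (norm_total_variationE fBV ay yz zb)/=.
set V := variation_fun a f z - variation_fun a f y.
have V0 : 0 <= V by rewrite subr_ge0; exact: (variation_fun_le fBV).
move: V0; rewrite le_eqVlt => /predU1P[<-|V0]; first by rewrite mulr0.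
rewrite ltr_norml => /andP[_]; rewrite distrC ltrBlDr -ltrBlDl ltr_pdivlMr//.
exact: ltW.
Qed.

End RegularSet.

(** * Sufficiency: the reparametrization by the inverse time change *)

Section Sufficiency.
Context {R : realType} {X : normedModType R}.
Variables (a b : R) (f : R -> X).
Hypothesis ab : a < b.
Hypothesis fcont : {within `[a, b], continuous f}.
Hypothesis fBV : (norm_total_variation a b f < +oo)%E.
Hypothesis Mnull : hausdorff1 (f @` Mb a b f) = 0%E.
Implicit Types (x y z t e m M : R).
Local Notation v := (variation_fun a f).
Local Notation C := (irregular_set a b f).

(** The last two clauses express that [v] has derivative [p] with respect to [u]; the measure theory
    enters the sequel only through this statement. *)
Lemma exists_time_change : exists p u : R -> R,
  [/\ continuous p, forall x, 0 <= p x, forall x, 0 < p x -> ~ C x,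
   (forall x e, x \in `[a, b] -> 0 < e -> exists2 d, 0 < d &
      forall y, y \in `[a, b] -> `|y - x| < d -> `|u y - u x| < e) &
   [/\ (forall x y, a <= x -> x < y -> y <= b -> u x < u y),
    (forall x y m, a <= x -> x <= y -> y <= b ->
      (forall z, x <= z -> z <= y -> m <= p z) -> m * (u y - u x) <= v y - v x) &
    (forall x y M, a <= x -> x <= y -> y <= b -> 0 < M ->
      (forall z, x <= z -> z <= y -> p z <= M) -> v y - v x <= M * (u y - u x))]].
Proof.
have Cclosed : closed C by exact: irregular_set_closed.
have Cnull : hausdorff1 (f @` C) = 0%E.
  exact: hausdorff1_le0 (image_irregular_set fcont) Mnull.
pose mu := curve_measure ab fcont fBV.
have muI x y : a <= x -> x <= y -> y <= b -> mu `]x, y]%classic = (v y - v x)%:E.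
  exact: curve_measure_itv.
have muC : mu (`]a, b]%classic `&` C) = 0%E by exact: curve_measure_C.
have mufin : (mu `]a, b]%classic < +oo)%E.
  by rewrite muI ?lexx ?ltry// ltW.
have C0 : C !=set0 by exists a; exact: irregular_set_left.
have [p [pcont pC pNC pint]] := exists_weight mufin Cclosed C0 muC.
have flat := irregular_set_flat fBV.
exists p, (time mu a p C); split => //.
- by move=> x; have [/pC->|/pNC/ltW] := pselect (C x).
- by move=> x px /pC px0; move: px; rewrite px0 ltxx.
- exact: (time_cts muI (variation_fun_cts fBV fcont) Cclosed pcont pC pNC pint).
- split.
  + move=> x y ax xy yb; rewrite -subr_gt0.
    rewrite (timeB Cclosed pcont pC pNC pint ax (ltW xy) yb).
    exact: (time_length_gt0 muI Cclosed muC pcont pC pNC pint flat).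
  + move=> x y m ax xy yb pm; rewrite (timeB Cclosed pcont pC pNC pint ax xy yb).
    exact: (time_length_le muI pcont pC pNC pint).
  + move=> x y M ax xy yb M0 pM; rewrite (timeB Cclosed pcont pC pNC pint ax xy yb).
    exact: (time_length_ge muI Cclosed muC pcont pC pNC pint).
Qed.

Lemma md_continuous_sufficient : exists h : R -> R,
  [/\ homeomorphism_of `[a, b] h,
      (forall x : R, x \in `[a, b] -> metrically_differentiable a b (f \o h) x)
    & {within `[a, b], continuous (md a b (f \o h))}].
Proof.
have [p [u [pcont p0 pC ucts [uinc ule uge]]]] := exists_time_change.
have aab : a \in `[a, b] by rewrite in_itv/= lexx ltW.
have bab : b \in `[a, b] by rewrite in_itv/= lexx ltW.
(* Rescaling by [c] makes [k] a map of [[a, b]] onto itself. *)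
pose c := (u b - u a) / (b - a).
have c0 : 0 < c by rewrite divr_gt0// subr_gt0//; exact: uinc.
pose k x := a + (u x - u a) / c.
have ka : k a = a by rewrite /k subrr mul0r addr0.
have kb : k b = b.
  rewrite /k /c invf_div mulrCA divff ?mulr1; first by ring.
  by rewrite gt_eqF// subr_gt0; exact: uinc.
have ku x y : u y - u x = c * (k y - k x).
  by rewrite /k; field; rewrite gt_eqF.
have kinc x y : a <= x -> x < y -> y <= b -> k x < k y.
  move=> ax xy yb; rewrite -subr_gt0 -(pmulr_rgt0 _ c0) -ku subr_gt0.
  exact: uinc.
have kle x y : a <= x -> x <= y -> y <= b -> k x <= k y.
  by move=> ax; rewrite le_eqVlt => /predU1P[->//|xy] yb; apply/ltW/kinc.
have kab x : x \in `[a, b] -> k x \in `[a, b].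
  by rewrite !in_itv/= => /andP[ax xb]; rewrite -{1}ka -{1}kb !kle// ltW.
have kcont : {within `[a, b], continuous k}.
  apply/(within_itv_continuousP a b (k : R -> R^o)) => x xab e e0.
  have [d d0 ud] := ucts x (c * e) xab (mulr_gt0 c0 e0); exists d => // y yab yd.
  by have := ud y yab yd; rewrite ku normrM gtr0_norm// ltr_pM2l.
have kinj x y : x \in `[a, b] -> y \in `[a, b] -> k x = k y -> x = y.
  rewrite !in_itv/= => /andP[ax xb] /andP[ay yb] kxy.
  by have [xy|yx|//] := ltgtP x y; [have := kinc _ _ ax xy yb|have := kinc _ _ ay yx xb];
    rewrite kxy ltxx.
pose h t := xget a [set x | x \in `[a, b] /\ k x = t].
have hP t : t \in `[a, b] -> h t \in `[a, b] /\ k (h t) = t.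
  move=> tab; rewrite /h; case: xgetP => [x -> //|/=].
  have [|x xab kxt] := IVT (ltW ab) kcont (v := t).
    by rewrite ka kb (min_idPl (ltW ab)) (max_idPr (ltW ab)); exact: tab.
  by move=> /(_ x)[].
have hab t (tab : t \in `[a, b]) : h t \in `[a, b] := (hP t tab).1.
have hk t (tab : t \in `[a, b]) : k (h t) = t := (hP t tab).2.
have kh x : x \in `[a, b] -> h (k x) = x.
  by move=> xab; apply: kinj => //; [exact/hab/kab|exact/hk/kab].
have hcont : {within `[a, b], continuous h}.
  have := segment_can_le_continuous (ltW ab) kcont kh.
  by rewrite ka kb.
have hle s t : a <= s -> s <= t -> t <= b -> h s <= h t.
  move=> as_ st tb; rewrite leNgt; apply/negP => hts.
  have sab : s \in `[a, b] by rewrite in_itv/=; lra.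
  have tab : t \in `[a, b] by rewrite in_itv/=; lra.
  have := hab s sab; have := hab t tab; rewrite !in_itv/= => /andP[h1 h2] /andP[h3 h4].
  by have := kinc _ _ h1 hts h4; rewrite !hk//; lra.
(* The derivative of [v \o h]: slope [p] of [v] in terms of [u], times slope [c] of [u] in terms of
   [k]. *)
pose P t := c * p (h t).
have P0 t : 0 <= P t by rewrite mulr_ge0// ltW.
have Pcts t e : t \in `[a, b] -> 0 < e -> exists2 d, 0 < d &
    forall s, s \in `[a, b] -> `|s - t| < d -> `|P s - P t| < e.
  move=> tab e0; have ec0 : 0 < e / c by rewrite divr_gt0.
  have := pcont (h t) => /cvgrPdist_lt/(_ _ ec0)/nbhs_ballP[d1 /= d10 pd1].
  have [d d0 hd] := (within_itv_continuousP a b (h : R -> R^o)).1 hcont t tab d1 d10.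
  exists d => // s sab sd; rewrite /P -mulrBr normrM (gtr0_norm c0) mulrC -ltr_pdivlMr//.
  by rewrite distrC; apply: pd1; rewrite /ball/= distrC; exact: hd.
have gmd t : t \in `[a, b] -> md_approx a b (f \o h) t (P t).
  move=> tab; apply: (@md_approx_arclength _ _ _ _ _ _ _ (v \o h)) => //.
  - move=> y z ay yz zb /=.
    have yab : y \in `[a, b] by rewrite in_itv/=; lra.
    have zab : z \in `[a, b] by rewrite in_itv/=; lra.
    have := hab y yab; have := hab z zab; rewrite !in_itv/= => /andP[_ hzb] /andP[ahy _].
    by apply: (variation_fun_dist fBV) => //; exact: hle.
  - move=> e e0; have [d d0 Pd] := Pcts t e tab e0; exists d => // y z ay yz zb yd zd.
    have yab : y \in `[a, b] by rewrite in_itv/=; lra.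
    have zab : z \in `[a, b] by rewrite in_itv/=; lra.
    have := hab y yab; have := hab z zab; rewrite !in_itv/= => /andP[_ hzb] /andP[ahy _].
    have hyz := hle y z ay yz zb.
    (* Each such [w] is [h (k w)] with [k w] between [y] and [z], hence close to [t], where
       continuity of [P] applies. *)
    have pz w : h y <= w -> w <= h z -> (P t - e) / c <= p w /\ p w <= (P t + e) / c.
      move=> w1 w2; have wab : w \in `[a, b] by rewrite in_itv/=; lra.
      have kw1 : y <= k w by rewrite -(hk y yab); apply: kle => //; lra.
      have kw2 : k w <= z by rewrite -(hk z zab); apply: kle => //; lra.
      have kwd : `|k w - t| < d.
        by move: yd zd; rewrite !ltr_norml => /andP[? ?] /andP[? ?]; lra.
      have := Pd (k w) (kab w wab) kwd; rewrite {1}/P kh// ltr_norml => /andP[l1 l2].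
      by rewrite ler_pdivrMr// ler_pdivlMr// (mulrC (p w)); split; lra.
    have Pe : 0 < (P t + e) / c by rewrite divr_gt0// ltr_wpDl.
    have lo := ule (h y) (h z) _ ahy hyz hzb (fun w w1 w2 => (pz w w1 w2).1).
    have hi := uge (h y) (h z) _ ahy hyz hzb Pe (fun w w1 w2 => (pz w w1 w2).2).
    have cK A w : A / c * (c * w) = A * w by field; rewrite gt_eqF.
    move: lo hi; rewrite ku !hk// !cK => lo hi.
    by rewrite ler_norml /=; apply/andP; split; lra.
  - move=> Pt e e0.
    have ht : 0 < p (h t) by move: Pt; rewrite /P pmulr_rgt0.
    have htab := hab t tab.
    (* Positivity of [p] at [h t] places that point off the irregular set. *)
    have reg : bilaterally_metrically_regular a b f (h t).
      apply: regular_interior_regular; apply: contrapT => nreg.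
      by apply: (pC _ ht); split.
    move: (htab); rewrite in_itv/= => /andP[aht htb].
    have [d1 d10 fd1] := regular_chord fBV aht htb reg e0.
    have [d d0 hd] := (within_itv_continuousP a b (h : R -> R^o)).1 hcont t tab d1 d10.
    exists d => // y z ay yt tz zb yd zd /=.
    have yab : y \in `[a, b] by rewrite in_itv/=; lra.
    have zab : z \in `[a, b] by rewrite in_itv/=; lra.
    have := hab y yab; have := hab z zab; rewrite !in_itv/= => /andP[_ hzb] /andP[ahy _].
    move: tab; rewrite in_itv/= => /andP[at_ tb].
    have := hd y yab; have := hd z zab; rewrite !ltr_norml => hz hy.
    apply: fd1 => //; [exact: hle|exact: hle| |].
      have /andP[? ?] : - d1 < h y - h t < d1 by apply: hy; lra.
      lra.
    have /andP[? ?] : - d1 < h z - h t < d1 by apply: hz; lra.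
    lra.
have mdE t : t \in `[a, b] -> md a b (f \o h) t = P t.
  by move=> tab; apply: md_approx_mdE => //; exact: gmd.
exists h; split.
- split; first split.
  + by move=> t; exact: hab.
  + by move=> s t /set_mem sab /set_mem tab hst; rewrite -(hk s sab) hst hk.
  + by move=> x xab; exists (k x); [exact: kab|exact: kh].
  + by exists k; split => // t /set_mem; exact: hk.
- by move=> t tab; apply/metrically_differentiableP => //; exists (P t); exact: gmd.
- apply/(within_itv_continuousP a b (md a b (f \o h) : R -> R^o)) => t tab e e0.
  have [d d0 Pd] := Pcts t e tab e0; exists d => // s sab sd.
  by rewrite !mdE//; exact: Pd.
Qed.

End Sufficiency.

Theorem theorem6p2 (R : realType) (X : completeNormedModType R)
    (a b : R) (hab : a < b) (f : R -> X) :
  (exists h : R -> R,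
     [/\ homeomorphism_of `[a, b] h,
         (forall x : R, x \in `[a, b] ->
            metrically_differentiable a b (f \o h) x)
       & {within `[a, b], continuous (md a b (f \o h))}])
  <->
  [/\ {within `[a, b], continuous f},
      (norm_total_variation a b f < +oo)%E
    & hausdorff1 (f @` Mb a b f) = 0%E].
Proof.
split=> [[h [hhomeo hmd mdcont]]|[fcont fBV Mnull]].
  exact: (md_continuous_necessary hab hhomeo hmd mdcont).
exact: md_continuous_sufficient.
Qed.
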